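(* Let $(S,\mathfrak n,k)$ be a complete regular local ring, let $0\neq f\in\mathfrak n^2$, and set $R=S/(f)$ and $A=S[\![u,v]\!]/(f+uv)$. Let $M$ be a maximal Cohen-Macaulay $R$-module with no non-zero free direct summands, and regard $M$ as an $A$-module through the surjection $A\to A/(u,v)=R$. Then $$\mathrm{syz}_2^A(M)\;\cong\; M^{\times}\oplus\left(\mathrm{syz}_1^R M\right)^{\times}=\left(M\oplus \mathrm{syz}_1^R M\right)^{\times},$$ and neither side has a non-zero free direct summand.
   Context: No hypothesis is placed on $k$ or its characteristic, and $S$ need not contain a field. All modules are finitely generated. For a local ring $\Gamma$, $\mathrm{syz}_i^\Gamma(X)$ denotes the $i$th syzygy of $X$ in a minimal free resolution over $\Gamma$. Write $B=S[\![u,v]\!]$. A matrix factorization of $f$ over $S$ is a pair $(\varphi\colon G\to F,\psi\colon F\to G)$ of homomorphisms of free $S$-modules of the same finite rank with $\psi\varphi=f\cdot1_G$ and $\varphi\psi=f\cdot1_F$; it is reduced if all entries lie in the maximal ideal, which holds if and only if its cokernel $\mathrm{cok}(\varphi,\psi):=\mathrm{cok}\,\varphi$ has no non-zero free summand. Reduced matrix factorizations of $f$ up to equivalence correspond bijectively, via $\mathrm{cok}$, to maximal Cohen-Macaulay (MCM) $R$-modules without non-zero free summands up to isomorphism, and for such $M=\mathrm{cok}(\varphi,\psi)$ one has $\mathrm{syz}_1^R M\cong\mathrm{cok}(\psi,\varphi)$. For an MCM $R$-module $M=\mathrm{cok}(\varphi,\psi)$ (with $(\varphi,\psi)$ taken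 reduced when $M$ has no non-zero free summand), $M^\times$ is the MCM $A$-module $$M^{\times}=\mathrm{cok}\left(\begin{bmatrix}\varphi & -v\,1_F\\ u\,1_G&\psi\end{bmatrix},\begin{bmatrix}\psi & v\,1_G\\ -u\,1_F&\varphi\end{bmatrix}\right),$$ the displayed pair being a matrix factorization of $f+uv$ over $B$. *)

(* Defs.v *)
From HB Require Import structures.
From mathcomp Require Import all_boot all_order all_algebra generic_quotient.
From mathcomp Require Import boolp classical_sets.

Set Implicit Arguments.
Unset Strict Implicit.
Unset Printing Implicit Defensive.

Import GRing.Theory.
Import ring_quotient.Quotient.
Local Open Scope ring_scope.
Local Open Scope quotient_scope.
Local Open Scope classical_set_scope.

(* Rings are [comPzRingType]s so that quotients by a principal ideal are again
   rings without a properness proof; nontriviality is part of [local_ring]. *)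

Section Ideals.
Variable R : comPzRingType.
Implicit Types I J P : set R.

Definition is_ideal I :=
  [/\ I 0, forall x y, I x -> I y -> I (x + y) & forall a x, I x -> I (a * x)].

Definition span_ideal n (x : 'I_n -> R) : set R :=
  [set y | exists c : 'I_n -> R, y = \sum_(i < n) c i * x i].

Definition noetherian :=
  forall I, is_ideal I -> exists n (x : 'I_n -> R), I = span_ideal x.

Definition prime_ideal P :=
  [/\ is_ideal P, ~ P 1 & forall x y, P (x * y) -> P x \/ P y].

Definition prime_chain d :=
  exists P : nat -> set R,
    (forall i, (i <= d)%N -> prime_ideal (P i)) /\
    (forall i, (i < d)%N -> P i `<` P i.+1).

Definition krull_dim d := prime_chain d /\ ~ prime_chain d.+1.

Definition ideal_mul I J : set R :=
  [set x | exists n (a b : 'I_n -> R),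
     (forall i, I (a i) /\ J (b i)) /\ x = \sum_(i < n) a i * b i].

Definition ideal_pow I n : set R := iter n (ideal_mul I) setT.

Definition adic_complete I :=
  (forall x, (forall i, ideal_pow I i x) -> x = 0) /\
  (forall x : nat -> R, (forall i, ideal_pow I i (x i.+1 - x i)) ->
     exists l, forall i, ideal_pow I i (l - x i)).

Definition invertible (x : R) := exists y, y * x = 1.

(* The set of nonunits; it is the maximal ideal when the ring is local. *)
Definition maxideal : set R := [set x | ~ invertible x].

Definition local_ring := (1 : R) <> 0 /\ is_ideal maxideal.

Definition regular_local_ring :=
  [/\ noetherian, local_ring &
      exists d (x : 'I_d -> R), krull_dim d /\ maxideal = span_ideal x].

End Ideals.

Section Modules.
Variable R : comPzRingType.

Definition fin_gen (M : lmodType R) :=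
  exists n (x : 'I_n -> M),
    forall y, exists c : 'I_n -> R, y = \sum_(i < n) c i *: x i.

Definition mod_iso (M N : lmodType R) :=
  exists h : {linear M -> N}, bijective h.

Definition has_free_summand (M : lmodType R) :=
  exists n (N : lmodType R), mod_iso M ('cV[R]_n.+1 * N)%type.

(* (s_0, ..., s_(i-1)) M *)
Definition seq_span (M : lmodType R) (s : seq R) i : set M :=
  [set y | exists z : nat -> M, y = \sum_(j < i) s`_j *: z j].

Definition regular_seq (M : lmodType R) (s : seq R) :=
  (forall i, (i < size s)%N -> forall x : M,
     @seq_span M s i (s`_i *: x) -> @seq_span M s i x) /\
  (exists x : M, ~ @seq_span M s (size s) x).

Definition depth (M : lmodType R) d :=
  (exists s, [/\ regular_seq M s, {in s, forall a, maxideal a} & size s = d]) /\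
  (forall s, regular_seq M s -> {in s, forall a, maxideal a} ->
     (size s <= d)%N).

(* The zero module, of infinite depth, counts as maximal Cohen-Macaulay. *)
Definition mcm (M : lmodType R) :=
  fin_gen M /\
  ((forall x : M, x = 0) \/ exists d, krull_dim R d /\ depth M d).

Definition im_pred m n (D : 'M[R]_(m, n)) : 'cV[R]_m -> bool :=
  fun y => `[< exists x : 'cV[R]_n, y = D *m x >].

Lemma im_submod m n (D : 'M[R]_(m, n)) : submod_closed (im_pred D).
Proof.
split=> [|a _ _ /asboolP[x ->] /asboolP[y ->]]; apply/asboolP.
  by exists 0; rewrite mulmx0.
by exists (a *: x + y); rewrite mulmxDr scalemxAr.
Qed.

HB.instance Definition _ m n (D : 'M[R]_(m, n)) :=
  GRing.isSubmodClosed.Build R 'cV[R]_m (im_pred D) (im_submod D).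

Record im_mod m n (D : 'M[R]_(m, n)) :=
  ImMod { im_val : 'cV[R]_m; _ : im_pred D im_val }.

HB.instance Definition _ m n (D : 'M[R]_(m, n)) :=
  [isSub for @im_val m n D].
HB.instance Definition _ m n (D : 'M[R]_(m, n)) :=
  [Choice of im_mod D by <:].
HB.instance Definition _ m n (D : 'M[R]_(m, n)) :=
  [SubChoice_isSubLmodule of im_mod D by <:].

(* Free modules are spaces of column vectors, so that a matrix acts on the left
   as a linear map; [mr_diff i] maps F_(i+1) to F_i. *)
Record min_resolution (M : lmodType R) := MinResolution {
  mr_rank : nat -> nat;
  mr_aug : {linear 'cV[R]_(mr_rank 0) -> M};
  mr_diff : forall i, 'M[R]_(mr_rank i, mr_rank i.+1);
  mr_surj : forall y, exists x, y = mr_aug x;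
  mr_exact0 : forall x, mr_aug x = 0 <-> exists y, x = mr_diff 0 *m y;
  mr_exact : forall i (x : 'cV[R]_(mr_rank i.+1)),
    mr_diff i *m x = 0 <-> exists y, x = mr_diff i.+1 *m y;
  mr_min : forall i j k, maxideal (mr_diff i j k)
}.

Definition syz (M : lmodType R) (F : min_resolution M) i : lmodType R :=
  if i is j.+1 then im_mod (mr_diff F j) else M.

End Modules.

Definition restrict (A R : comPzRingType) (h : {rmorphism A -> R})
  (M : lmodType R) : Type := M.

Section Restriction.
Variables (A R : comPzRingType) (h : {rmorphism A -> R}) (M : lmodType R).

HB.instance Definition _ := GRing.Zmodule.copy (restrict h M) M.

Definition restrict_scale (a : A) (x : restrict h M) : restrict h M :=
  h a *: (x : M).

Lemma restrict_scaleA a b x :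
  restrict_scale a (restrict_scale b x) = restrict_scale (a * b) x.
Proof. by rewrite /restrict_scale scalerA rmorphM. Qed.

Lemma restrict_scale1 : left_id 1 restrict_scale.
Proof. by move=> x; rewrite /restrict_scale rmorph1 scale1r. Qed.

Lemma restrict_scaleDr : right_distributive restrict_scale +%R.
Proof. by move=> a x y; apply: scalerDr. Qed.

Lemma restrict_scaleDl x : {morph restrict_scale^~ x : a b / a + b}.
Proof. by move=> a b; rewrite /restrict_scale rmorphD; apply: scalerDl. Qed.

HB.instance Definition _ := GRing.Zmodule_isLmodule.Build A (restrict h M)
  restrict_scaleA restrict_scale1 restrict_scaleDr restrict_scaleDl.

End Restriction.

Section PrincipalQuotient.
Variables (R : comPzRingType) (a : R).

Definition principal : R -> bool := fun x => `[< exists c, x = c * a >].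

Lemma principal_zmod : zmod_closed principal.
Proof.
split=> [|_ _ /asboolP[c ->] /asboolP[d ->]]; apply/asboolP.
  by exists 0; rewrite mul0r.
by exists (c - d); rewrite mulrBl.
Qed.

HB.instance Definition _ := GRing.isZmodClosed.Build R principal principal_zmod.

Definition rquot := {ideal_quot (GRing.ZmodClosed.clone R principal _)}.

HB.instance Definition _ := GRing.Zmodule.on rquot.

Definition rpi (x : R) : rquot := \pi_(rquot) x.

Definition rrepr (x : rquot) : R := repr x.

Lemma rpiK x : rpi (rrepr x) = x.
Proof. exact: reprK. Qed.

Lemma rpiP x y : rpi x = rpi y <-> exists c, x - y = c * a.
Proof.
split=> [/eqP|[c e]]; rewrite /rpi.
  by rewrite -idealrBE => /asboolP.
by apply/eqP; rewrite -idealrBE; apply/asboolP; exists c.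
Qed.

Lemma rpiD x y : rpi (x + y) = rpi x + rpi y.
Proof. by rewrite /rpi pi_add. Qed.

Definition rquot1 : rquot := rpi 1.
Definition rquot_mul (x y : rquot) : rquot := rpi (rrepr x * rrepr y).

Lemma rpiM x y : rpi (x * y) = rquot_mul (rpi x) (rpi y).
Proof.
apply/rpiP.
have [c ec] := (rpiP x (rrepr (rpi x))).1 (esym (rpiK _)).
have [d ed] := (rpiP y (rrepr (rpi y))).1 (esym (rpiK _)).
exists (c * y + rrepr (rpi x) * d).
rewrite mulrDl mulrAC -ec -mulrA -ed mulrBl mulrBr.
by rewrite addrA subrK.
Qed.

Lemma rquot_mulA : associative rquot_mul.
Proof.
by move=> x y z; rewrite -[x]rpiK -[y]rpiK -[z]rpiK -!rpiM mulrA.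
Qed.

Lemma rquot_mulC : commutative rquot_mul.
Proof. by move=> x y; rewrite /rquot_mul mulrC. Qed.

Lemma rquot_mul1 : left_id rquot1 rquot_mul.
Proof. by move=> x; rewrite -[x]rpiK -rpiM mul1r. Qed.

Lemma rquot_mulDl : left_distributive rquot_mul +%R.
Proof.
by move=> x y z; rewrite -[x]rpiK -[y]rpiK -[z]rpiK -!(rpiD, rpiM) mulrDl.
Qed.

HB.instance Definition _ := GRing.Zmodule_isComPzRing.Build rquot
  rquot_mulA rquot_mulC rquot_mul1 rquot_mulDl.

Lemma rpi_zmod : zmod_morphism rpi.
Proof. by move=> x y; apply/eqP; rewrite eq_sym subr_eq -rpiD subrK. Qed.

Lemma rpi_monoid : monoid_morphism rpi.
Proof. by split=> // x y; apply: rpiM. Qed.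

HB.instance Definition _ := GRing.isZmodMorphism.Build R rquot rpi rpi_zmod.
HB.instance Definition _ :=
  GRing.isMonoidMorphism.Build R rquot rpi rpi_monoid.

End PrincipalQuotient.

Record powser (R : Type) := PowSer { coefs : nat -> R }.

HB.instance Definition _ R := gen_eqMixin (powser R).
HB.instance Definition _ R := gen_choiceMixin (powser R).

Lemma powserP R (a b : powser R) : coefs a =1 coefs b -> a = b.
Proof. by case: a b => [a] [b] /= /funext ->. Qed.

Section PowerSeries.
Variable R : comPzRingType.
Implicit Types a b c : powser R.

Definition powserC (x : R) := PowSer (fun i => if i == 0 then x else 0).
Definition powserX : powser R := PowSer (fun i => (i == 1)%:R).
Definition powser_add a b := PowSer (fun i => coefs a i + coefs b i).
Definition powser_opp a := PowSer (fun i => - coefs a i).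
Definition powser_mul a b :=
  PowSer (fun i => \sum_(j < i.+1) coefs a j * coefs b (i - j)).

Lemma powser_addA : associative powser_add.
Proof. by move=> a b c; apply: powserP => i /=; rewrite addrA. Qed.
Lemma powser_addC : commutative powser_add.
Proof. by move=> a b; apply: powserP => i /=; rewrite addrC. Qed.
Lemma powser_add0 : left_id (powserC 0) powser_add.
Proof. by move=> a; apply: powserP => i /=; case: eqP; rewrite add0r. Qed.
Lemma powser_addN : left_inverse (powserC 0) powser_opp powser_add.
Proof. by move=> a; apply: powserP => i /=; case: eqP; rewrite addNr. Qed.

HB.instance Definition _ := GRing.isZmodule.Build (powser R)
  powser_addA powser_addC powser_add0 powser_addN.

Lemma powser_mulC : commutative powser_mul.
Proof.
move=> a b; apply: powserP => i /=; rewrite (reindex_inj rev_ord_inj) /=.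
by apply: eq_bigr => j _; rewrite mulrC subSS subKn // -ltnS.
Qed.

Lemma powser_mulA : associative powser_mul.
Proof.
move=> a b c; apply: powserP => i /=.
pose coef3 j k := coefs a j * (coefs b (i - j - k)%N * coefs c k).
transitivity (\sum_(j < i.+1) \sum_(k < i.+1 | (k <= i - j)%N) coef3 j k).
  apply: eq_bigr => j _.
  have -> : \sum_(k < (i - j).+1) coefs b k * coefs c (i - j - k)%N =
            \sum_(k < (i - j).+1) coefs b (i - j - k)%N * coefs c k.
    have /(congr1 (fun p => coefs p (i - j)%N)) /= := powser_mulC b c.
    by move=> ->; apply: eq_bigr => k _; rewrite mulrC.
  rewrite big_distrr /= (big_ord_narrow_leq (leq_subr _ _)).
  by apply: eq_bigr.
rewrite (exchange_big_dep predT) //=.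
rewrite [RHS](reindex_inj rev_ord_inj) /=; apply: eq_bigr => k _.
transitivity (\sum_(j < i.+1 | (j <= i - k)%N) coef3 j k).
  apply: eq_bigl => j; rewrite -ltnS -(ltnS j) -!subSn ?leq_ord //.
  by rewrite -subn_gt0 -(subn_gt0 j) -!subnDA addnC.
rewrite (big_ord_narrow_leq (leq_subr _ _)) subSS big_distrl /=.
rewrite subKn ?leq_ord //.
by apply: eq_bigr => j _; rewrite /coef3 /= mulrA -!subnDA addnC.
Qed.

Lemma powser_mul1 : left_id (powserC 1) powser_mul.
Proof.
move=> a; apply: powserP => i /=.
rewrite big_ord_recl /= mul1r subn0 big1 ?addr0 // => j _.
by rewrite mul0r.
Qed.

Lemma powser_mulDl : left_distributive powser_mul +%R.
Proof.
move=> a b c; apply: powserP => i /=; rewrite -big_split /=.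
by apply: eq_bigr => j _; rewrite mulrDl.
Qed.

HB.instance Definition _ := GRing.Zmodule_isComPzRing.Build (powser R)
  powser_mulA powser_mulC powser_mul1 powser_mulDl.

Lemma powserC_zmod : zmod_morphism powserC.
Proof. by move=> x y; apply: powserP => i /=; case: eqP; rewrite ?subr0. Qed.

Lemma powserC_monoid : monoid_morphism powserC.
Proof.
split=> // x y; apply: powserP => i /=; rewrite big_ord_recl /= subn0 big1.
  by case: eqP; rewrite ?mulr0 addr0.
by move=> j _; rewrite mul0r.
Qed.

HB.instance Definition _ :=
  GRing.isZmodMorphism.Build R (powser R) powserC powserC_zmod.
HB.instance Definition _ :=
  GRing.isMonoidMorphism.Build R (powser R) powserC powserC_monoid.

Definition coef0 a : R := coefs a 0.

Lemma coef0_zmod : zmod_morphism coef0.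
Proof. by []. Qed.

Lemma coef0_monoid : monoid_morphism coef0.
Proof. by split=> // a b; rewrite /coef0 /= big_ord1. Qed.

HB.instance Definition _ :=
  GRing.isZmodMorphism.Build (powser R) R coef0 coef0_zmod.
HB.instance Definition _ :=
  GRing.isMonoidMorphism.Build (powser R) R coef0 coef0_monoid.

End PowerSeries.

Arguments powserX {R}.

Section MatrixFactorizations.
Variables (S : comPzRingType) (f : S).

(* [mf_phi : G -> F] and [mf_psi : F -> G], where F = G = S^n. *)
Record matrix_factorization n := MatrixFactorization {
  mf_phi : 'M[S]_n;
  mf_psi : 'M[S]_n;
  mf_psiphi : mf_psi *m mf_phi = f%:M;
  mf_phipsi : mf_phi *m mf_psi = f%:M
}.

Definition reduced n (m : matrix_factorization n) :=
  forall i j, maxideal (mf_phi m i j) /\ maxideal (mf_psi m i j).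

Section Cokernel.
Variables (n : nat) (m : matrix_factorization n).

(* cok phi is killed by f, and is taken with its S/(f)-module structure. *)
Definition cok := {ideal_quot (GRing.ZmodClosed.clone 'cV[S]_n (im_pred (mf_phi m)) _)}.

HB.instance Definition _ := GRing.Zmodule.on cok.

Definition cpi (x : 'cV[S]_n) : cok := \pi_(cok) x.

Definition crepr (x : cok) : 'cV[S]_n := repr x.

Lemma cpiK x : cpi (crepr x) = x.
Proof. exact: reprK. Qed.

Lemma cpiP x y : cpi x = cpi y <-> exists z, x - y = mf_phi m *m z.
Proof.
split=> [/eqP|[c e]]; rewrite /cpi.
  by rewrite -idealrBE => /asboolP.
by apply/eqP; rewrite -idealrBE; apply/asboolP; exists c.
Qed.

Lemma cpiD x y : cpi (x + y) = cpi x + cpi y.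
Proof. by rewrite /cpi pi_add. Qed.

Definition cok_scale (a : rquot f) (x : cok) : cok :=
  cpi (rrepr a *: crepr x).

Lemma cok_scaleE (a : S) x : cok_scale (rpi f a) (cpi x) = cpi (a *: x).
Proof.
apply/cpiP.
have [c ec] := (rpiP f (rrepr (rpi f a)) a).1 (rpiK _).
have [z ez] := (cpiP (crepr (cpi x)) x).1 (cpiK _).
exists (rrepr (rpi f a) *: z + c *: (mf_psi m *m x)).
rewrite mulmxDr -!scalemxAr -ez mulmxA mf_phipsi mul_scalar_mx.
by rewrite scalerA -ec scalerBr scalerBl addrA subrK.
Qed.

Lemma cok_scaleA a b x : cok_scale a (cok_scale b x) = cok_scale (a * b) x.
Proof.
by rewrite -[a]rpiK -[b]rpiK -[x]cpiK -rmorphM !cok_scaleE scalerA.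
Qed.

Lemma cok_scale1 : left_id 1 cok_scale.
Proof. by move=> x; rewrite -[x]cpiK cok_scaleE scale1r. Qed.

Lemma cok_scaleDr : right_distributive cok_scale +%R.
Proof.
move=> a x y; rewrite -[a]rpiK -[x]cpiK -[y]cpiK.
by rewrite -cpiD !cok_scaleE scalerDr cpiD.
Qed.

Lemma cok_scaleDl x : {morph cok_scale^~ x : a b / a + b}.
Proof.
move=> a b; rewrite -[a]rpiK -[b]rpiK -[x]cpiK.
by rewrite -rpiD !cok_scaleE scalerDl cpiD.
Qed.

HB.instance Definition _ := GRing.Zmodule_isLmodule.Build (rquot f) cok
  cok_scaleA cok_scale1 cok_scaleDr cok_scaleDl.

End Cokernel.

End MatrixFactorizations.

Section BlockFactorization.
Variables (T : comPzRingType) (g u v : T) (n : nat) (phi psi : 'M[T]_n).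
Hypotheses (h1 : psi *m phi = g%:M) (h2 : phi *m psi = g%:M).

Lemma block_mf :
  block_mx psi v%:M (- u%:M) phi *m block_mx phi (- v%:M) u%:M psi =
  (g + u * v)%:M.
Proof.
rewrite mulmx_block !mulmxN !mulNmx h1 h2 !mul_scalar_mx !mul_mx_scalar.
by rewrite !addNr opprK !scale_scalar_mx [v * u]mulrC
           [_%:M + g%:M]addrC -raddfD -scalar_mx_block.
Qed.

Lemma block_mf' :
  block_mx phi (- v%:M) u%:M psi *m block_mx psi v%:M (- u%:M) phi =
  (g + u * v)%:M.
Proof.
rewrite mulmx_block !mulmxN !mulNmx h1 h2 !mul_scalar_mx !mul_mx_scalar.
by rewrite !subrr opprK !scale_scalar_mx [v * u]mulrC
           [_%:M + g%:M]addrC -raddfD -scalar_mx_block.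
Qed.

End BlockFactorization.

Section Cross.
Variables (S : comPzRingType) (f : S).

(* S[[u,v]] is S[[u]][[v]]. *)
Definition powser2 : comPzRingType := powser (powser S).
Definition ps_const : S -> powser2 := fun x => powserC (powserC x).
Definition ps_u : powser2 := powserC powserX.
Definition ps_v : powser2 := powserX.

HB.instance Definition _ :=
  GRing.RMorphism.copy ps_const (@powserC (powser S) \o @powserC S).

Definition fuv : powser2 := ps_const f + ps_u * ps_v.

Definition hyp_R : comPzRingType := rquot f.
Definition hyp_A : comPzRingType := rquot fuv.

Definition A_to_R (x : hyp_A) : hyp_R := rpi f (coef0 (coef0 (rrepr x))).

Lemma coef00_fuv : coef0 (coef0 fuv) = f.
Proof.
have -> : coef0 fuv = powserC f + powserX * 0.
  rewrite [LHS](rmorphD (@coef0 (powser S))).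
  by rewrite [X in _ + X](rmorphM (@coef0 (powser S))).
by rewrite mulr0 addr0.
Qed.

Lemma A_to_RE x : A_to_R (rpi fuv x) = rpi f (coef0 (coef0 x)).
Proof.
apply/rpiP.
have [c ec] := (rpiP fuv (rrepr (rpi fuv x)) x).1 (rpiK _).
exists (coef0 (coef0 c)); rewrite -[in RHS]coef00_fuv -!rmorphM -ec.
by rewrite !(rmorphB (@coef0 _)).
Qed.

Lemma A_to_R_zmod : zmod_morphism A_to_R.
Proof.
by move=> x y; rewrite -[x]rpiK -[y]rpiK -rmorphB !A_to_RE !rmorphB.
Qed.

Lemma A_to_R_monoid : monoid_morphism A_to_R.
Proof.
split=> [|x y]; first by rewrite A_to_RE !rmorph1.
by rewrite -[x]rpiK -[y]rpiK -rmorphM !A_to_RE !rmorphM.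
Qed.

HB.instance Definition _ :=
  GRing.isZmodMorphism.Build hyp_A hyp_R A_to_R A_to_R_zmod.
HB.instance Definition _ :=
  GRing.isMonoidMorphism.Build hyp_A hyp_R A_to_R A_to_R_monoid.

Definition inflate (M : lmodType hyp_R) : lmodType hyp_A := restrict A_to_R M.

Section CrossMF.
Variables (n : nat) (m : matrix_factorization f n).

Let phi : 'M[powser2]_n := map_mx ps_const (mf_phi m).
Let psi : 'M[powser2]_n := map_mx ps_const (mf_psi m).

Definition cross_phi := block_mx phi (- ps_v%:M) ps_u%:M psi.
Definition cross_psi := block_mx psi ps_v%:M (- ps_u%:M) phi.

Lemma cross_psiphi : cross_psi *m cross_phi = fuv%:M.
Proof.
by apply: block_mf; rewrite -map_mxM ?mf_psiphi ?mf_phipsi map_scalar_mx.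
Qed.

Lemma cross_phipsi : cross_phi *m cross_psi = fuv%:M.
Proof.
by apply: block_mf'; rewrite -map_mxM ?mf_psiphi ?mf_phipsi map_scalar_mx.
Qed.

Definition cross_mf : matrix_factorization fuv (n + n) :=
  MatrixFactorization cross_psiphi cross_phipsi.

End CrossMF.

(* N is (isomorphic to) the module obtained from M = cok(phi,psi). *)
Definition is_cross (M : lmodType hyp_R) (N : lmodType hyp_A) :=
  exists n (m : matrix_factorization f n),
    [/\ mod_iso M (cok m),
        ~ has_free_summand M -> reduced m &
        mod_iso N (cok (cross_mf m))].

End Cross.

(* Main.v *)
From HB Require Import structures.
From mathcomp Require Import all_boot all_order all_fingroup all_algebra.
From mathcomp Require Import boolp classical_sets.
From mathcomp Require Import ring.
Require Import Defs.

(** Over A, the module M = cok phi is presented by the row (phi u v), because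
    killing u and v turns A back into S/(f).  Everything rests on the next map
    of the resolution.  Let X be the factorization of f + uv with cokernel
    M^x, that is kphi = ((phi, -v), (u, psi)) and
    kpsi = ((psi, v), (-u, phi)).  Writing kpsi x = (x1, x2) and
    kphi y = (y1, y2), the vector (x1 + y2, -y1, -x2) is killed by (phi u v):
    the contribution of x is the first coordinate of kphi kpsi x = (f + uv) x
    and that of y is the second coordinate of kpsi kphi y = (f + uv) y.

    Conversely, a relation phi a + u b + v c = (f + uv) e over S[[u,v]] can be
    rewritten, after replacing a by a - psi e and c by c - u e, as a relation
    without right-hand side.  Modulo (u, v) it says that phi kills a constant
    vector, which must vanish since f is not a zero divisor; what remains is a
    Koszul relation on the regular sequence u, v, and its general solution has
    the displayed shape ([koszul_kernel]).  The vector is zero over A exactly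
    when x lies in the image of kphi and y in that of kpsi, because v is
    regular modulo f + uv ([koszul_relations]).  So the kernel of (phi u v) is
    cok X + cok (X with its two maps exchanged), and changing a sign identifies
    the second summand with the factorization attached to (psi, phi), whose
    cokernel over S/(f) is the first syzygy of M ([first_syzygy]).  All
    matrices involved have entries in the maximal ideal, so this is the minimal
    resolution: a surjection from a free module whose kernel consists of vectors
    with entries in the maximal ideal is unique up to an isomorphism of free
    modules ([minimal_covers_iso]), which gives [second_syzygy].  The same uniqueness
    shows that a reduced factorization is determined by its cokernel
    ([reduced_cok_equiv]), so the modules M^x do not depend on the chosen
    factorizations; and M^x is additive in M because the factorization attached to
    a direct sum is a direct sum ([knorrer_sum]).  Finally, a reduced factorization
    has no free summand in its cokernel because a row vector w with w phi = 0
    modulo f is a multiple of psi ([reduced_no_free_summand]); this applies over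
    S[[u,v]] as well, where the factorizations of f + uv stay reduced.

    All of this needs f to be a nonzerodivisor, that is, that a regular local
    ring is a domain.  The proof is by induction on the number d of generators
    of the maximal ideal.  Given a chain of primes P0 < ... < Pd, choose a
    generator x outside P0.  By Krull's principal ideal theorem the chain can be
    moved, with P0 fixed, so that P1 contains x; then S/(x) has a chain of
    length d - 1 and is a domain by induction.  Hence (x) is prime, and since a
    ring whose maximal ideal has d - 1 generators has no chain of length d,
    P1 = (x).  So P0 = x P0, and P0 = 0 by Nakayama's lemma. *)

Set Implicit Arguments.
Unset Strict Implicit.
Unset Printing Implicit Defensive.
Import GRing.Theory.
Local Open Scope ring_scope.
Local Open Scope classical_set_scope.

(** * Ideals and primes of a noetherian ring *)

Section IdealTheory.
Variable R : comPzRingType.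
Implicit Types (I J P Q : set R) (x y : R).

Lemma ideal0 I : is_ideal I -> I 0. Proof. by case. Qed.
Lemma idealD I x y : is_ideal I -> I x -> I y -> I (x + y).
Proof. by case=> _ h _; apply: h. Qed.
Lemma idealM I a x : is_ideal I -> I x -> I (a * x).
Proof. by case=> _ _; apply. Qed.
Lemma idealN I x : is_ideal I -> I x -> I (- x).
Proof. by move=> iI /(idealM (-1) iI); rewrite mulN1r. Qed.
Lemma idealB I x y : is_ideal I -> I x -> I y -> I (x - y).
Proof. by move=> iI Ix Iy; apply: idealD => //; apply: idealN. Qed.
Lemma ideal_sum I (T : Type) (r : seq T) (p : pred T) (F : T -> R) :
  is_ideal I -> (forall i, p i -> I (F i)) -> I (\sum_(i <- r | p i) F i).
Proof.
move=> iI h; apply: (big_ind I) => //; first exact: ideal0.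
by move=> x y; apply: idealD.
Qed.

Lemma span_gen n (x : 'I_n -> R) i : span_ideal x (x i).
Proof.
exists (fun j => (j == i)%:R).
rewrite (bigD1 i) //= eqxx mul1r big1 ?addr0 // => j /negPf ->.
by rewrite mul0r.
Qed.

Lemma span_sub n (x : 'I_n -> R) I :
  is_ideal I -> (forall i, I (x i)) -> span_ideal x `<=` I.
Proof. by move=> iI h _ [c ->]; apply: ideal_sum => // i _; apply: idealM. Qed.

(** The ideal I + (x). *)
Definition adjoin I x : set R := [set z | exists c, I (z - c * x)].

Lemma adjoinP I x : is_ideal I -> is_ideal (adjoin I x).
Proof.
move=> iI; split=> [|y z [c hc] [d hd]|a y [c hc]].
- by exists 0; rewrite mul0r subr0; apply: ideal0.
- by exists (c + d); rewrite mulrDl opprD addrACA; apply: idealD.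
- by exists (a * c); rewrite -mulrA -mulrBr; apply: idealM.
Qed.

Lemma sub_adjoin I x : I `<=` adjoin I x.
Proof. by move=> y Iy; exists 0; rewrite mul0r subr0. Qed.

Lemma adjoin_mem I x : is_ideal I -> adjoin I x x.
Proof. by move=> iI; exists 1; rewrite mul1r subrr; apply: ideal0. Qed.

Lemma primeN P x y : prime_ideal P -> ~ P x -> ~ P y -> ~ P (x * y).
Proof. by case=> _ _ pP nx ny /pP[]. Qed.

Lemma primeXN P x n : prime_ideal P -> ~ P x -> ~ P (x ^+ n).
Proof.
move=> pP nx; elim: n => [|n IHn]; first by rewrite expr0; case: pP.
by rewrite exprS; apply: primeN.
Qed.

(** If no member were maximal, choice would give a strictly increasing sequence
    in F, whose union is a finitely generated ideal and so is already reached. *)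
Lemma noetherian_max (F : set (set R)) I0 : noetherian R ->
  (forall I, F I -> is_ideal I) -> F I0 ->
  exists J, F J /\ (forall I, F I -> J `<=` I -> I `<=` J).
Proof.
move=> noeth idF FI0; apply: contrapT => nomax.
have step (I : {I | F I}) :
    exists I' : {I | F I}, sval I `<=` sval I' /\ ~ (sval I' `<=` sval I).
  apply: contrapT => h; apply: nomax; exists (sval I); split; first exact: svalP.
  move=> I' FI' sI; apply: contrapT => nsI; apply: h.
  by exists (exist _ I' FI').
have [g gP] := choice step.
pose s n := sval (iter n g (exist _ I0 FI0)).
have ids n : is_ideal (s n) by apply: idF; apply: svalP.
have mono m n : (m <= n)%N -> s m `<=` s n.
  elim: n => [|n IHn]; first by rewrite leqn0 => /eqP ->.
  rewrite leq_eqVlt => /predU1P[-> //|]; rewrite ltnS => /IHn h x /h.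
  by apply: (gP (iter n g _)).1.
pose U : set R := [set x | exists n, s n x].
have idU : is_ideal U.
  split=> [|x y [m hm] [n hn]|a x [n hn]].
  - by exists 0%N; apply: ideal0.
  - exists (maxn m n); apply: idealD => //.
    + by apply: (mono m _ _ _ hm); apply: leq_maxl.
    + by apply: (mono n _ _ _ hn); apply: leq_maxr.
  - by exists n; apply: idealM.
have [k [x Ux]] := noeth _ idU.
have /choice[N NP] : forall i, exists n, s n (x i).
  by move=> i; have : U (x i) by rewrite Ux; apply: span_gen.
pose n := (\max_i N i)%N.
have Us : U `<=` s n.
  rewrite Ux; apply: span_sub => // i; apply: (mono (N i) _ _ _ (NP i)).
  exact: leq_bigmax.
by apply: (gP (iter n g (exist _ I0 FI0))).2 => y hy; apply: Us; exists n.+1.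
Qed.

(** An ideal maximal among those containing I and missing T is prime. *)
Lemma prime_avoiding I (T : set R) : noetherian R -> is_ideal I -> T 1 ->
  (forall x y, T x -> T y -> T (x * y)) -> (forall x, I x -> ~ T x) ->
  exists P, [/\ prime_ideal P, I `<=` P & forall x, P x -> ~ T x].
Proof.
move=> noeth iI T1 TM dis.
pose F : set (set R) := [set J | [/\ is_ideal J, I `<=` J & forall x, J x -> ~ T x]].
have [J [[iJ IJ JT] maxJ]] : exists J, F J /\ (forall I, F I -> J `<=` I -> I `<=` J).
  apply: (noetherian_max noeth) => [K [] //|].
  by split; [|move=> x|exact: dis].
exists J; split=> //; split=> // [/JT //|x y Jxy].
have meets z : ~ J z -> exists2 t, adjoin J z t & T t.
  move=> nz; apply: contrapT => h; apply: nz; apply: (maxJ (adjoin J z)).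
  - split; first exact: adjoinP.
      by move=> w /IJ; apply: sub_adjoin.
    by move=> w hw Tw; apply: h; exists w.
  - exact: sub_adjoin.
  - exact: adjoin_mem.
apply: contrapT => /not_orP[/meets[t [c hc] Tt] /meets[t' [c' hc'] Tt']].
apply: (JT (t * t')) (TM _ _ Tt Tt').
have -> : t * t' = t' * (t - c * x) + (c * x) * (t' - c' * y) + (c * c') * (x * y).
  by ring.
by do !apply: idealD => //; apply: idealM.
Qed.

(** Modulo P the matrix is diagonal, with nonzero entries in a domain.  This one
    lemma serves both Nakayama's lemma and the inversion of matrices over a local
    ring. *)
Lemma det_notin_prime P n (D : 'M[R]_n) : prime_ideal P ->
  (forall i, ~ P (D i i)) -> (forall i j, i != j -> P (D i j)) -> ~ P (\det D).
Proof.
move=> pP diag off; have iP : is_ideal P by case: pP.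
rewrite /determinant (bigD1 1%g) //= => Pdet.
set r := \sum_(i | _) _ in Pdet.
have Pr : P r.
  apply: ideal_sum => // s s1; apply: idealM => //.
  have [i si] : exists i, s i != i.
    apply: contrapT => h; move/eqP: s1; apply; apply/permP => i.
    by rewrite perm1; apply/eqP/negP => /negP si; apply: h; exists i.
  by rewrite (bigD1 i) //= mulrC; apply: idealM => //; apply: off; rewrite eq_sym.
move: (idealB iP Pdet Pr); rewrite addrK odd_perm1 expr0 mul1r.
apply: (big_ind (fun z => ~ P z)); first by case: pP.
  by move=> x y; apply: primeN.
by move=> i _; rewrite perm1.
Qed.

(** Nakayama's lemma at the localization of R at P, without forming it: being
    killed in the localization means being killed by some s outside P.  The
    determinant of the matrix of coefficients is the common denominator. *)
Lemma nakayama P N n (y : 'I_n -> R) : prime_ideal P -> is_ideal N ->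
  (forall i, exists s (c : 'I_n -> R),
     [/\ ~ P s, forall j, P (c j) & N (s * y i - \sum_j c j * y j)]) ->
  exists2 s, ~ P s & forall i, N (s * y i).
Proof.
move=> pP iN /choice[s /choice[c h]]; have iP : is_ideal P by case: pP.
pose D : 'M[R]_n := \matrix_(i, j) ((i == j)%:R * s i - c i j).
exists (\det D) => [|i].
  apply: det_notin_prime => // [k|k j /negPf kj]; rewrite mxE.
    have [ns Pc _] := h k; rewrite eqxx mul1r => hs; apply: ns.
    by rewrite -[s k](subrK (c k k)); apply: idealD.
  by rewrite kj mul0r add0r; apply: idealN => //; have [_ ] := h k.
have -> : \det D * y i = \sum_k (\adj D) i k * (s k * y k - \sum_j c k j * y j).
  pose Y : 'cV[R]_n := \col_j y j.
  have /matrixP/(_ i 0) : (\adj D *m (D *m Y)) = (\det D)%:M *m Y.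
    by rewrite mulmxA mul_adj_mx.
  rewrite mul_scalar_mx [RHS]mxE [Y i 0]mxE => <-; rewrite mxE.
  apply: eq_bigr => k _; congr (_ * _); rewrite mxE.
  under eq_bigr => j _ do rewrite !mxE mulrBl.
  rewrite big_split /= sumrN; congr (_ - _).
  rewrite (bigD1 k) //= eqxx mul1r big1 ?addr0 // => j /negPf jk.
  by rewrite eq_sym jk !mul0r.
by apply: ideal_sum => // k _; apply: idealM => //; have [] := h k.
Qed.

End IdealTheory.

(** * Krull's principal ideal theorem *)

Section PrincipalIdealTheorem.
Variable R : comPzRingType.
Implicit Types (I J P Q : set R) (x y : R).

(** Saturated ideals are those that are contracted from the localization of R at P;
    [saturation P I] is the contraction of the extension of I. *)
Definition saturated P I := forall s y, ~ P s -> I (s * y) -> I y.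

Definition saturation P I : set R := [set y | exists2 s, ~ P s & I (s * y)].

Lemma saturation_ideal P I : prime_ideal P -> is_ideal I -> is_ideal (saturation P I).
Proof.
move=> pP iI; split=> [|x y [s ns hs] [t nt ht]|a x [s ns hs]].
- by exists 1; [case: pP | rewrite mulr0; apply: ideal0].
- exists (s * t); first exact: primeN.
  have -> : s * t * (x + y) = t * (s * x) + s * (t * y) by ring.
  by apply: idealD => //; apply: idealM.
- by exists s => //; rewrite mulrCA; apply: idealM.
Qed.

Lemma saturation_saturated P I : prime_ideal P -> saturated P (saturation P I).
Proof.
move=> pP s y ns [t nt h]; exists (t * s); first exact: primeN.
by rewrite -mulrA.
Qed.

Lemma sub_saturation P I : prime_ideal P -> I `<=` saturation P I.
Proof. by case=> _ n1 _ x Ix; exists 1; rewrite ?mul1r. Qed.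

(** Multiply 1 by the highest power of each p in turn that stays outside J. *)
Lemma socle_element J (s : seq R) : is_ideal J -> ~ J 1 ->
  (forall p, p \in s -> exists n, J (p ^+ n)) ->
  exists2 z, ~ J z & forall p, p \in s -> J (p * z).
Proof.
move=> iJ n1; elim: s => [|p s IHs] nil; first by exists 1.
have [|z nz hz] := IHs; first by move=> q qs; apply: nil; rewrite inE qs orbT.
have [n hn] := nil p (mem_head _ _).
have : exists n, `[< J (p ^+ n * z) >].
  by exists n; apply/asboolP; rewrite mulrC; apply: idealM.
case/ex_minnP=> -[|m] /asboolP hm minm; first by case: nz; rewrite -[z]mul1r.
exists (p ^+ m * z) => [hz'|q].
  by have := minm m; rewrite ltnn => /(_ (asboolT hz')).
rewrite inE => /predU1P[->|/hz qz]; first by rewrite mulrA -exprS.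
by rewrite mulrCA; apply: idealM.
Qed.

(** The localization of R/I0 at P is artinian when every element of P is nilpotent
    modulo I0.  Consider the ideals J for which the traces of D on J become
    stationary: if a maximal one were proper, an element z of the socle of R/J would
    add a one-dimensional layer, on which the trace can drop only once. *)
Lemma descending_stationary P I0 (D : nat -> set R) : noetherian R ->
  prime_ideal P -> is_ideal I0 -> saturated P I0 ->
  (forall z, P z -> exists n, I0 (z ^+ n)) ->
  (forall n, [/\ is_ideal (D n), saturated P (D n) & I0 `<=` D n]) ->
  (forall m n, (m <= n)%N -> D n `<=` D m) ->
  exists n0, forall n, (n0 <= n)%N -> D n0 `<=` D n.
Proof.
move=> noeth pP iI0 sI0 nilP hD decr; have iP : is_ideal P by case: pP.
pose F : set (set R) := [set J | [/\ is_ideal J, saturated P J, I0 `<=` J &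
  exists n0, forall n, (n0 <= n)%N -> forall w, D n0 w -> J w -> D n w]].
have [J [[iJ sJ IJ [n0 Jn0]] maxJ]] :
    exists J, F J /\ (forall I, F I -> J `<=` I -> I `<=` J).
  apply: (@noetherian_max _ _ I0 noeth) => [K [] //|].
  by split=> //; exists 0%N => n _ w _ I0w; have [_ _] := hD n; apply.
have [J1|n1] := pselect (J 1).
  exists n0 => n le_n w hw; apply: (Jn0 n le_n w hw).
  by rewrite -[w]mulr1; apply: idealM.
have [k [p eP]] := noeth P iP.
have [|z nz hz] := @socle_element J [seq p i | i <- enum 'I_k] iJ n1.
  move=> _ /mapP[i _ ->]; have [|n hn] := nilP (p i).
    by rewrite eP; apply: span_gen.
  by exists n; apply: IJ.
have Pz c : P c -> J (c * z).
  rewrite eP => -[d ->]; rewrite mulr_suml; apply: ideal_sum => // i _.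
  by rewrite -mulrA; apply: idealM => //; apply: hz; apply: map_f; rewrite mem_enum.
case: nz; apply: (maxJ (saturation P (adjoin J z))); first last.
- by apply: sub_saturation => //; apply: adjoin_mem.
- by move=> w Jw; apply: sub_saturation => //; apply: sub_adjoin.
split.
- by apply: saturation_ideal => //; apply: adjoinP.
- exact: saturation_saturated.
- by move=> w /IJ Jw; apply: sub_saturation => //; apply: sub_adjoin.
(* If no D n meets the new layer inside J only, each D n has an element w' outside J
   there, and subtracting a multiple of w' moves any w of D n0 into J. *)
have [[n hn]|never] := pselect (exists n, forall w, D n w ->
    saturation P (adjoin J z) w -> J w).
  exists (maxn n n0) => m; rewrite geq_max => /andP[nm n0m] w Dw J'w.
  apply: Jn0 => //; first by apply: decr Dw; apply: leq_maxr.
  by apply: hn J'w; apply: decr Dw; apply: leq_maxl.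
exists n0 => n le_n w Dw [t nt [c' hc']].
have [w' [Dw' [s ns [c hc]] nJ]] : exists w',
    [/\ D n w', saturation P (adjoin J z) w' & ~ J w'].
  apply: contrapT => h; apply: never; exists n => v Dv J'v.
  by apply: contrapT => nJ; apply: h; exists v.
have [iDn sDn _] := hD n; have [iDn0 _ _] := hD n0.
have nc : ~ P c.
  move=> Pc; apply: nJ; apply: (sJ s) => //.
  by rewrite -[s * w'](subrK (c * z)); apply: idealD => //; apply: Pz.
have Dn0w' : D n0 w' by apply: decr Dw'.
apply: (sDn (c * t)); first exact: primeN.
rewrite -[_ * w](subrK (c' * s * w')); apply: idealD => //; last exact: idealM.
apply: Jn0 => //; first by apply: idealB => //; apply: idealM.
have -> : c * t * w - c' * s * w' = c * (t * w - c' * z) - c' * (s * w' - c * z).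
  by ring.
by apply: idealB => //; apply: idealM.
Qed.

(** The principal ideal theorem, in the form that moves one link of a chain of
    primes so as to contain x.  If P were minimal over P0 + (x), the localization of
    R/(P0 + (x)) at P would be artinian.  With q in Q outside P0, let E n be the
    contraction of P0 + (q^n) from the localization at Q.  The ideals E n + (x) are
    stationary, so E n = E (n+1) + x E n because x is outside Q, and Nakayama gives
    E n = E (n+1).  Then s q^n = c q^(n+1) modulo P0 with s outside Q, so that
    s - c q lies in P0 and s in Q, which is absurd. *)
Lemma principal_ideal_swap P0 Q P x : noetherian R ->
  prime_ideal P0 -> prime_ideal Q -> prime_ideal P ->
  P0 `<` Q -> Q `<` P -> P x -> ~ Q x ->
  exists P', [/\ prime_ideal P', P0 `<=` P', P' `<` P & P' x].
Proof.
move=> noeth pP0 pQ pP [P0Q nQP0] [QP nPQ] Px nQx.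
apply: contrapT => noP'.
have iP0 : is_ideal P0 by case: pP0.
have iQ : is_ideal Q by case: pQ.
have iP : is_ideal P by case: pP.
have [q Qq nq] : exists2 q, Q q & ~ P0 q.
  by apply: contrapT => h; apply: nQP0 => q Qq; apply: contrapT => nq; apply: h; exists q.
pose I0 := saturation P (adjoin P0 x).
pose E n := saturation Q (adjoin P0 (q ^+ n)).
pose D n := saturation P (adjoin (E n) x).
have iE n : is_ideal (E n) by apply: saturation_ideal => //; apply: adjoinP.
have sE n : saturated Q (E n) by apply: saturation_saturated.
have decrE m n : (m <= n)%N -> E n `<=` E m.
  move=> /subnK <- y [s ns [c hc]]; exists s => //; exists (c * q ^+ (n - m)).
  by rewrite -mulrA -exprD.
have nilP z : P z -> exists n, I0 (z ^+ n).
  move=> Pz; apply: contrapT => nnil.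
  (* A prime that misses T lies inside P and does not contain z. *)
  pose T : set R := [set t | exists s n, ~ P s /\ t = s * z ^+ n].
  have [||||P' [pP' subP' avoid]] :=
    @prime_avoiding R (adjoin P0 x) T noeth.
  - exact: adjoinP.
  - by exists 1, 0%N; rewrite mulr1; split=> //; case: pP.
  - move=> _ _ [s [m [ns ->]]] [t [n [nt ->]]]; exists (s * t), (m + n)%N.
    by rewrite exprD mulrACA; split=> //; apply: primeN.
  - by move=> t h [s [n [ns e]]]; apply: nnil; exists n, s; rewrite -?e.
  apply: noP'; exists P'; split=> //.
  - by move=> y P0y; apply: subP'; apply: sub_adjoin.
  - split=> [y P'y|PP'].
      apply: contrapT => nPy; apply: (avoid y) => //.
      by exists y, 0%N; rewrite mulr1.
    apply: (avoid z); first exact: PP'.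
    by exists 1, 1%N; rewrite mul1r expr1; split=> //; case: pP.
  - by apply: subP'; apply: adjoin_mem.
have [n hn] : exists n0, forall n, (n0 <= n)%N -> D n0 `<=` D n.
  apply: (@descending_stationary P I0) => //.
  - by apply: saturation_ideal => //; apply: adjoinP.
  - exact: saturation_saturated.
  - move=> n; split; first by apply: saturation_ideal => //; apply: adjoinP.
      exact: saturation_saturated.
    move=> y [s ns [c hc]]; exists s => //; exists c.
    by apply: sub_saturation => //; apply: sub_adjoin.
  - move=> m n le_mn y [s ns [c hc]]; exists s => //; exists c.
    exact: (decrE m n le_mn).
have subE : E n `<=` E n.+1.
  have [k [y ey]] := noeth _ (iE n).
  have Ey i : E n (y i) by rewrite ey; apply: span_gen.
  have [i|s ns hs] := @nakayama R P (E n.+1) k y pP (iE _).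
    have [s ns [r hr]] : D n.+1 (y i).
      by apply: (hn n.+1 (leqnSn n)); apply: sub_saturation => //; apply: sub_adjoin.
    have : E n r.
      apply: (sE n x) => //; rewrite mulrC -[r * x](subKr (s * y i)).
      by apply: idealB => //; [apply: idealM | apply: (decrE n n.+1)].
    rewrite ey => -[c er]; exists s, (fun j => x * c j); split=> // [j|].
      by rewrite mulrC; apply: idealM.
    rewrite er mulrC mulr_suml in hr; move: hr; congr (E _ (_ - _)).
      by rewrite mulrC.
    by apply: eq_bigr => j _; rewrite mulrAC [c j * x]mulrC.
  rewrite ey; apply: span_sub => // i.
  by apply: (sE _ s) (hs i) => /QP.
have [s ns [c hc]] : E n.+1 (q ^+ n).
  by apply: subE; apply: sub_saturation => //; apply: adjoin_mem.
have : P0 (q ^+ n * (s - c * q)).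
  by move: hc; congr P0; rewrite exprSr; ring.
have [_ _ primeP0] := pP0; case/primeP0; first exact: primeXN.
move/P0Q => hQ; apply: ns; rewrite -[s](subrK (c * q)).
by apply: idealD => //; apply: idealM.
Qed.

End PrincipalIdealTheorem.

(** * Regular local rings are domains *)

Section LocalRings.
Variable R : comPzRingType.
Implicit Types (I J P Q : set R) (x y : R).

Lemma invertibleM x y : invertible x -> invertible y -> invertible (x * y).
Proof. by move=> [a ax] [b by_]; exists (a * b); rewrite mulrACA ax by_ mulr1. Qed.

Lemma invertible_factor x y : invertible (x * y) -> invertible y.
Proof. by move=> [a e]; exists (a * x); rewrite -mulrA. Qed.

Hypothesis locR : local_ring R.

Lemma maxideal_ideal : is_ideal (@maxideal R). Proof. by case: locR. Qed.

Lemma maxideal_prime : prime_ideal (@maxideal R).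
Proof.
split; first exact: maxideal_ideal.
  by apply; exists 1; rewrite mulr1.
move=> x y; rewrite /maxideal /= => nxy; apply: contrapT => /not_orP[].
by move=> /contrapT ix /contrapT iy; apply: nxy; apply: invertibleM.
Qed.

Lemma prime_sub_maxideal P : prime_ideal P -> P `<=` @maxideal R.
Proof. by move=> [iP n1 _] x Px [y yx]; apply: n1; rewrite -yx; apply: idealM. Qed.

Lemma maxideal_unit x : maxideal x -> invertible (1 + x).
Proof.
move=> mx; apply: contrapT => m1x; case: maxideal_prime => iM n1 _; apply: n1.
by rewrite -(addrK x 1); apply: idealB.
Qed.

End LocalRings.

Section PrimeChains.
Variable R : comPzRingType.
Implicit Types (P : nat -> set R) (Q : set R) (x y : R).

Definition is_chain d (P : nat -> set R) :=
  (forall i, (i <= d)%N -> prime_ideal (P i)) /\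
  (forall i, (i < d)%N -> P i `<` P i.+1).

Definition chain_rcons d (P : nat -> set R) Q i := if (i <= d)%N then P i else Q.

Lemma is_chain_rcons d P Q : is_chain d P -> prime_ideal Q -> P d `<` Q ->
  is_chain d.+1 (chain_rcons d P Q).
Proof.
move=> [pP sP] pQ PQ; rewrite /chain_rcons; split=> i hi; first by case: ifP => // /pP.
rewrite -ltnS hi; case: ifP => [/sP //|]; move: hi; rewrite ltnS leq_eqVlt.
by case/predU1P => [->|->].
Qed.

Lemma is_chain_take d k P : (k <= d)%N -> is_chain d P -> is_chain k P.
Proof.
move=> kd [pP sP]; split=> i hi; first by apply: pP; apply: leq_trans kd.
by apply: sP; apply: leq_trans kd.
Qed.

(** The links are swapped from the top down, and the bottom prime never moves;
    keeping it is what lets a generator outside P 0 be used below. *)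
Lemma chain_through d P x : noetherian R -> is_chain d.+1 P -> P d.+1 x ->
  exists P', [/\ is_chain d.+1 P', P' 0 = P 0 & P' 1 x].
Proof.
move=> noeth cP Px.
suff [P' [? ? _ ?]] : exists P',
  [/\ is_chain d.+1 P', P' 0 = P 0, P' d.+1 = P d.+1 & P' 1 x] by exists P'.
elim: d P cP Px => [|d IHd] P cP Px; first by exists P.
have [pP sP] := cP.
have [W [pW PW WP Wx]] : exists W, [/\ prime_ideal W, P d `<` W, W `<` P d.+2 & W x].
  have [Pdx|nPdx] := pselect (P d.+1 x).
    by exists (P d.+1); split=> //; [apply: pP | apply: sP; apply: leqW | apply: sP].
  have Pd := sP d (leqnSn _).
  have [|||W [pW PW WP Wx]] :=
    principal_ideal_swap noeth _ _ _ Pd (sP d.+1 (leqnn _)) Px nPdx.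
  - by apply: pP; do 2 apply: leqW.
  - exact: pP.
  - exact: pP.
  exists W; split=> //; split=> // /(_ _ Wx); by move/Pd.1.
have [] := IHd (chain_rcons d P W).
- by apply: is_chain_rcons => //; apply: is_chain_take cP; do 2 apply: leqW.
- by rewrite /chain_rcons ltnn.
move=> P' [cP' P'0 P'd P'x]; exists (chain_rcons d.+1 P' (P d.+2)); split.
- by apply: is_chain_rcons => //; [apply: pP | rewrite P'd /chain_rcons ltnn].
- by rewrite /chain_rcons /= P'0.
- by rewrite /chain_rcons ltnn.
- by [].
Qed.

Lemma chain_to_maxideal d : local_ring R -> prime_chain R d.+1 ->
  exists2 P, is_chain d.+1 P & P d.+1 = @maxideal R.
Proof.
move=> loc [P cP]; exists (chain_rcons d P (@maxideal R)); last first.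
  by rewrite /chain_rcons ltnn.
apply: is_chain_rcons; first by apply: is_chain_take cP.
  exact: maxideal_prime.
have [pP sP] := cP; have [PP nPP] := sP d (leqnn _).
have Pm := prime_sub_maxideal (pP d.+1 (leqnn _)).
by split=> [x /PP /Pm //|mP]; apply: nPP => x /Pm /mP.
Qed.

End PrimeChains.

Section LocalQuotient.
Variables (R : comPzRingType) (a : R).

Definition ideal_image (P : set R) : set (rquot a) := [set y | P (rrepr y)].

(** Representatives are only determined up to multiples of a, so statements about
    [rquot a] are transported along this correction. *)
Lemma rrepr_rpi (y : R) : exists c, rrepr (rpi a y) = y + c * a.
Proof.
have [c e] := (rpiP a (rrepr (rpi a y)) y).1 (rpiK _).
by exists c; rewrite -e addrC subrK.
Qed.

Lemma ideal_imageE (P : set R) y : is_ideal P -> P a -> ideal_image P (rpi a y) <-> P y.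
Proof.
move=> iP Pa; rewrite /ideal_image /=; have [c ->] := rrepr_rpi y.
have Pca : P (c * a) by apply: idealM.
by split=> [h|]; [rewrite -[y](addrK (c * a)); apply: idealB | move/idealD; apply].
Qed.

Lemma prime_image (P : set R) : prime_ideal P -> P a -> prime_ideal (ideal_image P).
Proof.
move=> [iP n1 pP] Pa; have E y := @ideal_imageE P y iP Pa.
split; first split.
- by rewrite -(rmorph0 (rpi a)); apply/E; apply: ideal0.
- move=> x y; rewrite -[x]rpiK -[y]rpiK => /E hx /E hy.
  by rewrite -rmorphD; apply/E; apply: idealD.
- move=> b x; rewrite -[x]rpiK -[b]rpiK => /E hx.
  by rewrite -rmorphM; apply/E; apply: idealM.
- by rewrite -(rmorph1 (rpi a)) => /E.
- move=> x y; rewrite -[x]rpiK -[y]rpiK -rmorphM => /E /pP[] h.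
    by left; apply/E.
  by right; apply/E.
Qed.

Lemma proper_image (P Q : set R) : is_ideal P -> is_ideal Q -> P a -> P `<` Q ->
  ideal_image P `<` ideal_image Q.
Proof.
move=> iP iQ Pa [PQ nQP]; have Qa := PQ _ Pa; split=> [y|h]; first exact: PQ.
by apply: nQP => y Qy; apply/(ideal_imageE y iP Pa)/h/(ideal_imageE y iQ Qa).
Qed.

Lemma rquot_noetherian : noetherian R -> noetherian (rquot a).
Proof.
move=> noeth I iI; pose J : set R := [set y | I (rpi a y)].
have iJ : is_ideal J.
  split=> [|x y Ix Iy|b x Ix]; rewrite /J /= ?rmorph0 ?rmorphD ?rmorphM.
  - exact: ideal0.
  - exact: idealD.
  - exact: idealM.
have [n [x eJ]] := noeth J iJ.
have Jx i : J (x i) by rewrite eJ; apply: span_gen.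
exists n, (fun i => rpi a (x i)); apply/seteqP; split; last exact: span_sub.
move=> y; rewrite -[y]rpiK => Iy.
have : J (rrepr y) by [].
rewrite eJ => -[c ->]; exists (fun i => rpi a (c i)).
by rewrite rmorph_sum; apply: eq_bigr => i _; rewrite rmorphM.
Qed.

Hypotheses (locR : local_ring R) (ma : maxideal a).

Lemma invertible_rpi y : invertible (rpi a y) <-> invertible y.
Proof.
split=> [[x]|[x e]]; last by exists (rpi a x); rewrite -rmorphM e rmorph1.
rewrite -[x]rpiK -rmorphM -(rmorph1 (rpi a)) => /rpiP[c e].
apply: (@invertible_factor _ (rrepr x)).
rewrite -(subrK 1 (_ * y)) e addrC; apply: maxideal_unit => //.
by apply: idealM => //; apply: maxideal_ideal.
Qed.

Lemma maxideal_rpi y : maxideal (rpi a y) <-> maxideal y.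
Proof. by split=> n /invertible_rpi. Qed.

Lemma rquot_local : local_ring (rquot a).
Proof.
split=> [|].
  rewrite -(rmorph1 (rpi a)) -(rmorph0 (rpi a)) => /rpiP[c]; rewrite subr0 => e.
  case: (maxideal_prime locR) => iM n1 _; apply: n1; rewrite e.
  exact: idealM.
have iM := maxideal_ideal locR; split=> [|x y|b x].
- by rewrite -(rmorph0 (rpi a)); apply/maxideal_rpi; apply: ideal0.
- rewrite -[x]rpiK -[y]rpiK => /maxideal_rpi hx /maxideal_rpi hy.
  by rewrite -rmorphD; apply/maxideal_rpi; apply: idealD.
- rewrite -[x]rpiK -[b]rpiK => /maxideal_rpi hx.
  by rewrite -rmorphM; apply/maxideal_rpi; apply: idealM.
Qed.

Lemma rquot_maxideal_span d (x : 'I_d.+1 -> R) i : @maxideal R = span_ideal x ->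
  x i = a -> @maxideal (rquot a) = span_ideal (fun j => rpi a (x (lift i j))).
Proof.
move=> eM xi; have iM := maxideal_ideal rquot_local; apply/seteqP; split.
  move=> y; rewrite -[y]rpiK => /maxideal_rpi; rewrite eM => -[c ->].
  exists (fun j => rpi a (c (lift i j))).
  have rpia : rpi a a = 0.
    by rewrite -(rmorph0 (rpi a)); apply/rpiP; exists 1; rewrite subr0 mul1r.
  rewrite (bigD1_ord i) //= xi rmorphD rmorphM /= rpia mulr0 add0r rmorph_sum.
  by apply: eq_bigr => j _; rewrite rmorphM.
by apply: span_sub => // j; apply/maxideal_rpi; rewrite eM; apply: span_gen.
Qed.

Lemma image_chain d P : is_chain d P -> P 0 a ->
  is_chain d (fun i => ideal_image (P i)).
Proof.
move=> [pP sP] P0a.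
have Pa i : (i <= d)%N -> P i a.
  elim: i => [//|i IHi] hi; apply: (sP i hi).1; apply: IHi; exact: ltnW.
split=> i hi; first by apply: prime_image; [apply: pP | apply: Pa].
apply: proper_image; last exact: sP.
- by case: (pP i (ltnW hi)).
- by case: (pP i.+1 hi).
- by apply: Pa; apply: ltnW.
Qed.

End LocalQuotient.

Lemma is_chain_behead (R : comPzRingType) d (P : nat -> set R) :
  is_chain d.+1 P -> is_chain d (fun i => P i.+1).
Proof. by move=> [pP sP]; split=> i hi; [apply: pP | apply: sP]. Qed.

(** Half of the dimension theorem: d generators of the maximal ideal bound the length
    of prime chains by d.  Move the chain through the first generator and divide
    by it. *)
Lemma chain_length_bound d (R : comPzRingType) (x : 'I_d -> R) : noetherian R ->
  local_ring R -> @maxideal R = span_ideal x -> ~ prime_chain R d.+1.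
Proof.
elim: d R x => [|d IHd] R x noeth loc eM chain.
  have [P [pP sP] _] := chain_to_maxideal loc chain.
  have [_] := sP 0%N (ltn0Sn _); apply=> y /(prime_sub_maxideal (pP 1%N (leqnn _))).
  rewrite eM => -[c ->]; rewrite big_ord0.
  by apply: ideal0; case: (pP 0%N (leq0n _)).
have mx : maxideal (x ord0) by rewrite eM; apply: span_gen.
have [P cP eP] := chain_to_maxideal loc chain.
have [P' [cP' _ P'x]] : exists P', [/\ is_chain d.+2 P', P' 0 = P 0 & P' 1 (x ord0)].
  by apply: chain_through; rewrite ?eP.
apply: (IHd (rquot (x ord0))) (rquot_maxideal_span loc mx eM erefl) _.
- exact: rquot_noetherian.
- exact: rquot_local.
by exists (fun i => ideal_image (P' i.+1)); apply: image_chain => //; apply: is_chain_behead.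
Qed.

Definition is_domain (R : comPzRingType) := forall x y : R, x * y = 0 -> x = 0 \/ y = 0.

Lemma regular_is_domain d (R : comPzRingType) (x : 'I_d -> R) : noetherian R ->
  local_ring R -> @maxideal R = span_ideal x -> prime_chain R d -> is_domain R.
Proof.
elim: d R x => [|d IHd] R x noeth loc eM chain.
  move=> a b ab; have [[c ca]|] := pselect (invertible a).
    by right; rewrite -[b]mul1r -ca -mulrA ab mulr0.
  change (maxideal a -> a = 0 \/ b = 0); rewrite eM => -[c ->]; left.
  by rewrite big_ord0.
have [P cP eP] := chain_to_maxideal loc chain; have [pP sP] := cP.
have iM := maxideal_ideal loc.
have [i nPx] : exists i, ~ P 0 (x i).
  apply: contrapT => h; have [_] := sP 0%N (ltn0Sn _); apply.
  move=> y /(prime_sub_maxideal (pP 1%N (ltn0Sn _))); rewrite eM.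
  apply: span_sub => [|i]; first by case: (pP 0%N (leq0n _)).
  by apply: contrapT => ?; apply: h; exists i.
have mx : maxideal (x i) by rewrite eM; apply: span_gen.
have [P' [cP' P'0 P'x]] : exists P', [/\ is_chain d.+1 P', P' 0 = P 0 & P' 1 (x i)].
  by apply: chain_through; rewrite ?eP.
have loc' := rquot_local loc mx; have noeth' := @rquot_noetherian _ (x i) noeth.
have eM' := rquot_maxideal_span loc mx eM erefl.
have cQ : is_chain d (fun j => @ideal_image _ (x i) (P' j.+1)).
  by apply: image_chain => //; apply: is_chain_behead.
have dom' : is_domain (rquot (x i)).
  by apply: IHd eM' _ => //; exists (fun j => ideal_image (P' j.+1)).
(* Otherwise 0 could be put below the image of P' 1, and the chain of the quotient
   would be too long. *)
have P'1 y : P' 1 y -> exists c, y = c * x i.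
  move=> P'y; apply: contrapT => ny; apply: (chain_length_bound noeth' loc' eM').
  exists (fun j => if j is k.+1 then ideal_image (P' k.+1) else [set 0]).
  have [pQ sQ] := cQ; split=> [] [|j] hj; last 2 first.
  - split=> [_ ->|h]; first by apply: ideal0; case: (pQ 0%N (leq0n _)).
    apply: ny; have : [set 0] (rpi (x i) y).
      apply: h; apply/ideal_imageE => //.
      by case: (cP'.1 1%N (ltn0Sn _)).
    rewrite /= -(rmorph0 (rpi (x i))) => /rpiP[c].
    by rewrite subr0 => ->; exists c.
  - exact: sQ.
  - split; last by move=> a b /= /dom'.
      by split=> /= [//|a b -> ->|a b ->]; rewrite ?addr0 ?mulr0.
    by case: loc'.
  - exact: pQ.
have pP0 := pP 0%N (leq0n _); have [iP0 _ pP0'] := pP0.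
have [k [y eP0]] := noeth _ iP0.
have P0y j : P 0 (y j) by rewrite eP0; apply: span_gen.
have [|j|s ns hs] := @nakayama R (@maxideal R) [set 0] k y (maxideal_prime loc) _.
- by split=> [//|a b -> ->|a b ->]; rewrite /= ?addr0 ?mulr0.
- have [c ec] : exists c, y j = c * x i.
    by apply: P'1; apply: (cP'.2 0%N (ltn0Sn _)).1; rewrite P'0.
  have : P 0 c by move: (P0y j); rewrite ec => /pP0'[].
  rewrite eP0 => -[b eb]; exists 1, (fun l => x i * b l); split.
  - by case: (maxideal_prime loc).
  - by move=> l; rewrite mulrC; apply: idealM.
  rewrite /= mul1r ec eb mulr_suml; apply/eqP; rewrite subr_eq0; apply/eqP.
  by apply: eq_bigr => l _; rewrite mulrAC [b l * _]mulrC.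
have y0 j : y j = 0.
  move/contrapT: ns => -[t ts]; rewrite -[y j]mul1r -ts -mulrA.
  by rewrite [s * _](hs j) mulr0.
have P0_0 z : P 0 z -> z = 0.
  by rewrite eP0 => -[c ->]; rewrite big1 // => j _; rewrite y0 mulr0.
move=> a b ab; have : P 0 (a * b) by rewrite ab; apply: ideal0.
by case/pP0' => /P0_0; [left|right].
Qed.

Lemma regular_local_domain (R : comPzRingType) : regular_local_ring R -> is_domain R.
Proof. by move=> [noeth loc [d [x [[chain _] eM]]]]; apply: regular_is_domain eM chain. Qed.

(** * Isomorphisms of modules and minimal covers *)

Section ModuleIso.
Variable R : comPzRingType.
Implicit Types M N : lmodType R.

Lemma mod_isoI M N (h : M -> N) : (forall a x y, h (a *: x + y) = a *: h x + h y) ->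
  (forall x, h x = 0 -> x = 0) -> (forall y, exists x, h x = y) -> mod_iso M N.
Proof.
move=> lin inj /choice[g gK].
pose H : {linear M -> N} := HB.pack h (GRing.isLinear.Build R M N *:%R h lin).
exists H, g => // x; apply/eqP; rewrite -subr_eq0; apply/eqP; apply: inj.
by rewrite -[h]/(H : M -> N) raddfB /= gK subrr.
Qed.

Lemma mod_iso_inv M N : mod_iso M N -> exists h : {linear N -> M},
  (forall x, h x = 0 -> x = 0) /\ (forall y, exists x, h x = y).
Proof.
move=> [h [g hK gK]].
have lin a x y : g (a *: x + y) = a *: g x + g y.
  by apply: (can_inj hK); rewrite linearP !gK.
pose G : {linear N -> M} := HB.pack g (GRing.isLinear.Build R N M *:%R g lin).
exists G; split=> /= [x|y].
  by move/(congr1 h); rewrite gK raddf0.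
by exists (h y); rewrite hK.
Qed.

Lemma mod_iso_refl M : mod_iso M M.
Proof. by exists idfun; exists idfun. Qed.

Lemma mod_iso_sym M N : mod_iso M N -> mod_iso N M.
Proof.
by move=> /mod_iso_inv[h [inj surj]]; apply: (@mod_isoI _ _ h) => // a x y; rewrite linearP.
Qed.

Lemma mod_iso_trans N M P : mod_iso M N -> mod_iso N P -> mod_iso M P.
Proof.
move=> [h hb] [g gb]; exists (g \o h : {linear M -> P}).
exact: bij_comp.
Qed.

Lemma mod_iso_prod M N M' N' :
  mod_iso M M' -> mod_iso N N' -> mod_iso (M * N)%type (M' * N')%type.
Proof.
move=> [h [g hK gK]] [k [l kK lK]].
apply: (@mod_isoI _ _ (fun x => (h x.1, k x.2))) => [a x y|[x y]|[x y]] /=.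
- by rewrite !linearP.
- by case=> /(congr1 g) + /(congr1 l); rewrite hK kK -(raddf0 h) -(raddf0 k) hK kK => -> ->.
- by exists (g x, l y); rewrite gK lK.
Qed.

Lemma free_summand_iso M N : mod_iso M N -> has_free_summand M -> has_free_summand N.
Proof. by move=> /mod_iso_sym i [n [L j]]; exists n, L; apply: mod_iso_trans j. Qed.

End ModuleIso.

Section MinimalCovers.
Variable R : comPzRingType.

Lemma column_sum n (x : 'cV[R]_n) : x = \sum_j x j 0 *: delta_mx j 0.
Proof.
rewrite [LHS]matrix_sum_delta; apply: eq_bigr => j _.
by rewrite big_ord1.
Qed.

Section LinearCombination.
Variables (M : lmodType R) (n : nat) (e : 'I_n -> M).

Definition lincomb (x : 'cV[R]_n) : M := \sum_j x j 0 *: e j.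

Lemma lincomb_linear a x y : lincomb (a *: x + y) = a *: lincomb x + lincomb y.
Proof.
rewrite /lincomb scaler_sumr -big_split /=; apply: eq_bigr => j _.
by rewrite !mxE scalerDl scalerA.
Qed.

HB.instance Definition _ :=
  GRing.isLinear.Build R 'cV[R]_n M *:%R lincomb lincomb_linear.

End LinearCombination.

(** Free modules are projective. *)
Lemma lift_matrix (M : lmodType R) a b (p : {linear 'cV[R]_a -> M})
    (q : {linear 'cV[R]_b -> M}) :
  (forall x, exists y, q y = p x) -> exists D : 'M[R]_(b, a), forall x, q (D *m x) = p x.
Proof.
move=> h; have /choice[c hc] := fun j => h (delta_mx j 0).
exists (\matrix_(i, j) c j i 0) => x.
rewrite {2}[x]column_sum linear_sum.
have -> : (\matrix_(i, j) c j i 0) *m x = \sum_j x j 0 *: c j.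
  apply/matrixP => i k; rewrite ord1 !mxE summxE; apply: eq_bigr => j _.
  by rewrite !mxE mulrC.
by rewrite linear_sum; apply: eq_bigr => j _; rewrite !linearZ_LR hc.
Qed.

Lemma mulmx_in_ideal (I : set R) a b c (D : 'M[R]_(a, b)) (X : 'M[R]_(b, c)) :
  is_ideal I -> (forall i j, I (D i j)) -> forall i j, I ((D *m X) i j).
Proof.
move=> iI h i j; rewrite mxE; apply: ideal_sum => // k _.
by rewrite mulrC; apply: idealM.
Qed.

Hypothesis locR : local_ring R.

Lemma unipotent_inverse n (D : 'M[R]_n) : (forall i j, maxideal ((D - 1%:M) i j)) ->
  exists2 B, B *m D = 1%:M & D *m B = 1%:M.
Proof.
move=> h; have : ~ maxideal (\det D).
  have hD i j : D i j = (D - 1%:M) i j + (i == j)%:R by rewrite !mxE subrK.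
  apply: det_notin_prime (maxideal_prime locR) _ _ => [i|i j /negPf ij].
    by rewrite hD eqxx addrC; apply; apply: maxideal_unit.
  by rewrite hD ij addr0.
move/contrapT=> [c e]; exists (c *: \adj D).
  by rewrite -scalemxAl mul_adj_mx scale_scalar_mx e.
by rewrite -scalemxAr mul_mx_adj scale_scalar_mx e.
Qed.

(** M need not be covered: only the images of p and q have to agree, so that the
    lemma also compares two minimal covers of a submodule, such as two second steps of
    a minimal resolution.  Composing the lifts in both orders gives matrices that are
    the identity modulo the maximal ideal. *)
Lemma minimal_covers_iso (M : lmodType R) a b (p : {linear 'cV[R]_a -> M})
    (q : {linear 'cV[R]_b -> M}) :
  (forall x, exists y, q y = p x) -> (forall y, exists x, p x = q y) ->
  (forall x, p x = 0 -> forall i, maxideal (x i 0)) ->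
  (forall y, q y = 0 -> forall i, maxideal (y i 0)) ->
  exists (D : 'M[R]_(b, a)) (E : 'M[R]_(a, b)),
    [/\ D *m E = 1%:M, E *m D = 1%:M & forall x, q (D *m x) = p x].
Proof.
move=> /lift_matrix[D hD] /lift_matrix[E hE] minp minq.
have minM c (r : {linear 'cV[R]_c -> M}) (C : 'M[R]_c) :
    (forall x, r x = 0 -> forall i, maxideal (x i 0)) ->
    (forall x, r (C *m x) = r x) -> exists2 B, B *m C = 1%:M & C *m B = 1%:M.
  move=> minr hC; apply: unipotent_inverse => i j.
  have := minr ((C - 1%:M) *m delta_mx j 0); rewrite mulmxBl mul1mx linearB hC subrr.
  by move=> /(_ erefl i); rewrite -colE -[X in _ - X]mul1mx -colE !mxE.
have [|B BED _] := minM a p (E *m D) minp; first by move=> x; rewrite -mulmxA hE hD.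
have [|C _ DEC] := minM b q (D *m E) minq; first by move=> x; rewrite -mulmxA hD hE.
exists D, (B *m E); split=> //; last by rewrite -mulmxA.
suff -> : B *m E = E *m C by rewrite mulmxA.
by rewrite -[LHS]mulmx1 -DEC !mulmxA -(mulmxA B) BED mul1mx.
Qed.

End MinimalCovers.

Lemma column_factor (R : comPzRingType) k l c (C : 'M[R]_(k, c)) (B : 'M[R]_(k, l)) :
  (forall x : 'cV_c, exists z, C *m x = B *m z) -> exists Z, C = B *m Z.
Proof.
move=> hC; have [|Z hZ] := @lift_matrix R 'cV_k _ _ (mulmx C) (mulmx B).
  by move=> x; have [z e] := hC x; exists z.
exists Z; apply/matrixP => i j.
move: (hZ (delta_mx j 0)) => /= /matrixP/(_ i 0).
by rewrite mulmxA -!colE !mxE => <-.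
Qed.

(** * Matrix factorizations and their cokernels *)

Section Factorizations.
Variables (S : comPzRingType) (f : S).

Definition nonzerodivisor (T : comPzRingType) (a : T) := forall x, a * x = 0 -> x = 0.

Lemma scalemx_nzd (T : comPzRingType) (a : T) p q (X : 'M[T]_(p, q)) :
  nonzerodivisor a -> a *: X = 0 -> X = 0.
Proof.
move=> nzd /matrixP h; apply/matrixP => i j; rewrite mxE; apply: nzd.
by have := h i j; rewrite !mxE.
Qed.

Section Cok.
Variables (n : nat) (m : matrix_factorization f n).

Lemma cpi0P x : cpi m x = 0 <-> exists z, x = mf_phi m *m z.
Proof.
have c0 : cpi m 0 = 0 by apply: (@addrI _ (cpi m 0)); rewrite -cpiD !addr0.
by rewrite -{1}c0; rewrite cpiP subr0.
Qed.

Lemma cpiZ a x : cpi m (a *: x) = rpi f a *: cpi m x.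
Proof. by rewrite -[RHS]/(cok_scale _ _) cok_scaleE. Qed.

(** Universal property of the cokernel, phrased on column vectors over S although
    [cok m] is a module over S/(f). *)
Lemma cok_iso (N : lmodType (rquot f)) (g : 'cV[S]_n -> N) :
  (forall x y, g (x + y) = g x + g y) -> (forall a x, g (a *: x) = rpi f a *: g x) ->
  (forall y, exists x, g x = y) ->
  (forall x, g x = 0 <-> exists z, x = mf_phi m *m z) -> mod_iso (cok m) N.
Proof.
move=> gD gZ gsurj gker.
have gB x y : g (x - y) = g x - g y.
  by apply: (@addIr _ (g y)); rewrite -gD !subrK.
have E x : g (crepr (cpi m x)) = g x.
  have [z ez] := (cpiP m (crepr (cpi m x)) x).1 (cpiK _).
  by apply/eqP; rewrite -subr_eq0 -gB; apply/eqP/gker; exists z.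
apply: (@mod_isoI _ _ _ (fun c => g (crepr c))) => [a x y|x|y].
- by rewrite -[a]rpiK -[x]cpiK -[y]cpiK -cpiZ -cpiD !E gD gZ.
- by rewrite -[x]cpiK E => /gker h; apply/cpi0P.
- by have [x <-] := gsurj y; exists (cpi m x); rewrite E.
Qed.

Definition mf_op := MatrixFactorization (mf_phipsi m) (mf_psiphi m).

Hypothesis nzf : nonzerodivisor f.

Lemma mf_phi_inj k (X Y : 'M[S]_(n, k)) : mf_phi m *m X = mf_phi m *m Y -> X = Y.
Proof.
move=> /(congr1 (mulmx (mf_psi m))); rewrite !mulmxA mf_psiphi !mul_scalar_mx => /eqP.
by rewrite -subr_eq0 -scalerBr => /eqP /(scalemx_nzd nzf) /eqP; rewrite subr_eq0 => /eqP.
Qed.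

Lemma mf_kernel k (X : 'M[S]_(n, k)) Y :
  mf_phi m *m X = f *: Y -> X = mf_psi m *m Y.
Proof.
move=> h; apply: mf_phi_inj; rewrite h mulmxA mf_phipsi.
by rewrite mul_scalar_mx.
Qed.

End Cok.

Lemma mf_op_reduced n (m : matrix_factorization f n) : reduced m -> reduced (mf_op m).
Proof. by move=> h i j; have [] := h i j. Qed.

(** A map from the cokernel onto S/(f) is given by a row W with W phi = f C, and then
    W = C psi has entries in the maximal ideal, so that the map is not onto. *)
Lemma reduced_no_free_summand n (m : matrix_factorization f n) : local_ring S ->
  maxideal f -> nonzerodivisor f -> reduced m -> ~ has_free_summand (cok m).
Proof.
move=> loc maxf nzf red [k [N [h [g hK gK]]]].
have iM := maxideal_ideal loc.
pose val (c : cok m) : rquot f := (h c).1 0 0.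
have /choice[w hw] : forall j, exists w, rpi f w = val (cpi m (delta_mx j 0)).
  by move=> j; exists (rrepr (val (cpi m (delta_mx j 0)))); rewrite rpiK.
pose W : 'rV[S]_n := \row_j w j.
have valD : forall x y, val (x + y) = val x + val y.
  by move=> x y; rewrite /val raddfD /= mxE.
have val0 : val 0 = 0 by rewrite /val raddf0 /= mxE.
have valE x : val (cpi m x) = rpi f ((W *m x) 0 0).
  rewrite mxE rmorph_sum {1}[x]column_sum.
  have -> : cpi m (\sum_j x j 0 *: delta_mx j 0) =
            \sum_j rpi f (x j 0) *: cpi m (delta_mx j 0).
    rewrite (big_morph _ (cpiD m) ((cpi0P m 0).2 _)); last by exists 0; rewrite mulmx0.
    by apply: eq_bigr => j _; rewrite cpiZ.
  rewrite (big_morph _ valD val0); apply: eq_bigr => j _.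
  by rewrite rmorphM /= mxE hw /val linearZ_LR /= mxE mulrC.
have [C eC] : exists C, W *m mf_phi m = f *: C.
  have /choice[c hc] : forall j, exists c, (W *m mf_phi m) 0 j = c * f.
    move=> j; have : val (cpi m (mf_phi m *m delta_mx j 0)) = 0.
      by rewrite -val0; congr val; apply/cpi0P; exists (delta_mx j 0).
    rewrite valE mulmxA -(rmorph0 (rpi f)) => /rpiP[c].
    by rewrite subr0 -colE mxE => e; exists c.
  by exists (\row_j c j); apply/rowP => j; rewrite hc !mxE mulrC.
have eW : W = C *m mf_psi m.
  apply/eqP; rewrite -subr_eq0; apply/eqP/(scalemx_nzd nzf).
  rewrite scalerBr -mul_mx_scalar -(mf_phipsi m) mulmxA eC.
  by rewrite scalemxAl subrr.
have [c hc] : exists c, val c = 1.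
  by exists (g (const_mx 1, 0)); rewrite /val gK /= mxE.
move: hc; rewrite -[c]cpiK valE -(rmorph1 (rpi f)) => /rpiP[b eb].
case: (maxideal_prime loc) => _ n1 _; apply: n1.
rewrite -[1](subKr ((W *m crepr c) 0 0)) eb; apply: idealB => //; last exact: idealM.
rewrite mxE; apply: ideal_sum => // j _; rewrite mulrC; apply: idealM => //.
rewrite eW mxE; apply: ideal_sum => // i _; apply: idealM => //.
by have [] := red i j.
Qed.

(** D' and E' need not be mutually inverse: an isomorphism of cokernels sees only the
    image of the first map of each factorization. *)
Lemma cok_equiv n1 n2 (m1 : matrix_factorization f n1) (m2 : matrix_factorization f n2)
    (D : 'M[S]_(n2, n1)) E D' E' :
  D *m mf_phi m1 = mf_phi m2 *m D' -> E *m mf_phi m2 = mf_phi m1 *m E' ->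
  D *m E = 1%:M -> E *m D = 1%:M -> mod_iso (cok m1) (cok m2).
Proof.
move=> hD hE DE ED; apply: (@cok_iso _ m1 _ (fun x => cpi m2 (D *m x))) => [x y|a x|y|x].
- by rewrite mulmxDr cpiD.
- by rewrite -scalemxAr cpiZ.
- by exists (E *m crepr y); rewrite mulmxA DE mul1mx cpiK.
split=> [/cpi0P[z ez]|[z ->]].
  exists (E' *m z); rewrite mulmxA -hE -mulmxA -ez mulmxA ED.
  by rewrite mul1mx.
by apply/cpi0P; exists (D' *m z); rewrite mulmxA hD mulmxA.
Qed.

(** Both factorizations give minimal covers of the same module, whence D; the
    remaining matrices and relations follow by cancelling the injective maps phi. *)
Lemma reduced_cok_equiv n1 n2 (m1 : matrix_factorization f n1)
    (m2 : matrix_factorization f n2) :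
  local_ring S -> nonzerodivisor f -> reduced m1 -> reduced m2 ->
  mod_iso (cok m1) (cok m2) ->
  exists (D D' : 'M[S]_(n2, n1)) E E',
    [/\ [/\ D *m E = 1%:M, E *m D = 1%:M, D' *m E' = 1%:M & E' *m D' = 1%:M],
        D *m mf_phi m1 = mf_phi m2 *m D' & D' *m mf_psi m1 = mf_psi m2 *m D].
Proof.
move=> loc nzf red1 red2 [h [g hK gK]].
pose N : lmodType S := restrict (rpi f) (cok m2).
have plin a x y : (h (cpi m1 (a *: x + y)) : N) = a *: (h (cpi m1 x) : N) + h (cpi m1 y).
  by rewrite cpiD cpiZ linearP.
have qlin a x y : (cpi m2 (a *: x + y) : N) = a *: (cpi m2 x : N) + cpi m2 y.
  by rewrite cpiD cpiZ.
pose p : {linear 'cV[S]_n1 -> N} := HB.pack (fun x => h (cpi m1 x) : N)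
  (GRing.isLinear.Build S 'cV[S]_n1 N *:%R _ plin).
pose q : {linear 'cV[S]_n2 -> N} := HB.pack (fun x => cpi m2 x : N)
  (GRing.isLinear.Build S 'cV[S]_n2 N *:%R _ qlin).
have kerp x : p x = 0 -> exists z, x = mf_phi m1 *m z.
  move=> hx; apply/cpi0P; apply: (can_inj hK); rewrite raddf0; exact: hx.
have phi_max k (m : matrix_factorization f k) z i :
    reduced m -> maxideal ((mf_phi m *m z : 'cV_k) i 0).
  move=> red; apply: mulmx_in_ideal; first exact: maxideal_ideal.
  by move=> i' j'; have [] := red i' j'.
have [||||D [E [DE ED hD]]] := @minimal_covers_iso S loc N _ _ p q.
- by move=> x; exists (crepr (h (cpi m1 x))); apply: cpiK.
- by move=> y; exists (crepr (g (cpi m2 y))); rewrite /p /= cpiK gK.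
- by move=> x /kerp[z ->] i; apply: phi_max.
- by move=> x /cpi0P[z ->] i; apply: phi_max.
have [D' hD'] : exists D', D *m mf_phi m1 = mf_phi m2 *m D'.
  apply: column_factor => x; apply/cpi0P.
  rewrite -[LHS]/(q _) -mulmxA hD /p /=.
  by rewrite (iffRL (cpi0P m1 _)) ?raddf0 //; exists x.
have [E' hE'] : exists E', E *m mf_phi m2 = mf_phi m1 *m E'.
  apply: column_factor => x; apply: kerp; rewrite -hD !mulmxA DE mul1mx.
  by apply/cpi0P; exists x.
exists D, D', E, E'; split=> //; first split=> //.
- apply: (mf_phi_inj (m := m2) nzf); rewrite mulmx1 mulmxA -hD' -mulmxA -hE'.
  by rewrite mulmxA DE mul1mx.
- apply: (mf_phi_inj (m := m1) nzf); rewrite mulmx1 mulmxA -hE' -mulmxA -hD'.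
  by rewrite mulmxA ED mul1mx.
- apply: (mf_phi_inj (m := m2) nzf); rewrite mulmxA -hD' -mulmxA mf_phipsi.
  by rewrite mulmxA mf_phipsi mul_mx_scalar mul_scalar_mx.
Qed.

Section DirectSum.
Variables (n1 n2 : nat) (m1 : matrix_factorization f n1) (m2 : matrix_factorization f n2).

Lemma mf_sum_subproof (A B : 'M[S]_n1) (C D : 'M[S]_n2) :
  A *m B = f%:M -> C *m D = f%:M ->
  block_mx A 0 0 C *m block_mx B 0 0 D = f%:M.
Proof.
move=> hA hC; rewrite mulmx_block !mulmx0 !mul0mx !addr0 !add0r hA hC.
by rewrite -scalar_mx_block.
Qed.

Definition mf_sum := MatrixFactorization
  (mf_sum_subproof (mf_psiphi m1) (mf_psiphi m2))
  (mf_sum_subproof (mf_phipsi m1) (mf_phipsi m2)).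

Lemma mf_sum_cok : mod_iso (cok mf_sum) (cok m1 * cok m2)%type.
Proof.
apply: (@cok_iso _ mf_sum _ (fun x => (cpi m1 (usubmx x), cpi m2 (dsubmx x)))).
- by move=> x y; rewrite !linearD !cpiD.
- by move=> a x; rewrite !linearZ /= !cpiZ.
- by move=> [x y]; exists (col_mx (crepr x) (crepr y)); rewrite col_mxKu col_mxKd !cpiK.
move=> x; rewrite -[x]vsubmxK col_mxKu col_mxKd.
split=> [[/cpi0P[y ->] /cpi0P[z ->]]|[z]].
  by exists (col_mx y z); rewrite mul_block_col !mul0mx addr0 add0r.
rewrite -[z]vsubmxK mul_block_col !mul0mx addr0 add0r => /eq_col_mx[-> ->].
by congr pair; apply/cpi0P; [exists (usubmx z)|exists (dsubmx z)].
Qed.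

Lemma mf_sum_reduced : local_ring S -> reduced m1 -> reduced m2 -> reduced mf_sum.
Proof.
move=> loc r1 r2 i j; have m0 := ideal0 (maxideal_ideal loc).
rewrite /= !mxE; case: splitP => i' _; rewrite !mxE; case: splitP => j' _; rewrite ?mxE //.
Qed.

End DirectSum.

End Factorizations.

(** * The factorization of f + uv attached to one of f *)

Section Columns.
Variables (R : comPzRingType) (u v : R) (n : nat).
Implicit Types x y z : 'cV[R]_n.

Lemma col_split x y : (forall i, exists s t, x i 0 = y i 0 + u * s + v * t) ->
  exists s t, x = y + u *: s + v *: t.
Proof.
move=> /choice[s /choice[t h]]; exists (\col_i s i), (\col_i t i).
by apply/colP => i; rewrite !mxE; apply: h.
Qed.

Lemma col_koszul : (forall a b, u * a + v * b = 0 -> exists w, a = v * w /\ b = - (u * w)) ->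
  forall y z, u *: y + v *: z = 0 -> exists w, y = v *: w /\ z = - (u *: w).
Proof.
move=> hu y z h.
have /choice[w hw] : forall i, exists w, y i 0 = v * w /\ z i 0 = - (u * w).
  by move=> i; apply: hu; move/colP/(_ i): h; rewrite !mxE.
by exists (\col_i w i); split; apply/colP => i; rewrite !mxE; case: (hw i).
Qed.

Lemma col_regular : (forall a b, v * a = u * b -> exists c, a = u * c) ->
  forall x y, v *: x = u *: y -> exists z, x = u *: z.
Proof.
move=> hv x y h; have /choice[c hc] : forall i, exists c, x i 0 = u * c.
  by move=> i; apply: (hv _ (y i 0)); move/colP/(_ i): h; rewrite !mxE.
by exists (\col_i c i); apply/colP => i; rewrite !mxE.
Qed.

End Columns.

Section Hypersurface.
Variables (S B : comPzRingType) (iota : {rmorphism S -> B}) (ev : {rmorphism B -> S}).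
Variables (u v : B) (f : S).

Local Notation F := (iota f + u * v).

Section Matrices.
Variables (n : nat) (m : matrix_factorization f n).
Local Notation phi := (map_mx iota (mf_phi m)).
Local Notation psi := (map_mx iota (mf_psi m)).

Lemma map_psiphi : psi *m phi = (iota f)%:M.
Proof. by rewrite -map_mxM mf_psiphi map_scalar_mx. Qed.

Lemma map_phipsi : phi *m psi = (iota f)%:M.
Proof. by rewrite -map_mxM mf_phipsi map_scalar_mx. Qed.

(** The factorization with cokernel M^x, over any ring B under S.  The arguments below
    use only a retraction of B onto S with kernel (u, v) and the regularity of a few
    elements, so B stays abstract until the end and no power series are computed
    with. *)
Definition knorrer : matrix_factorization F (n + n) := MatrixFactorization
  (block_mf u v map_psiphi map_phipsi) (block_mf' u v map_psiphi map_phipsi).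
Local Notation kphi := (mf_phi knorrer).
Local Notation kpsi := (mf_psi knorrer).

Lemma knorrer_phiE (x y : 'cV[B]_n) :
  kphi *m col_mx x y = col_mx (phi *m x - v *: y) (u *: x + psi *m y).
Proof. by rewrite mul_block_col mulNmx !mul_scalar_mx. Qed.

Lemma knorrer_psiE (x y : 'cV[B]_n) :
  kpsi *m col_mx x y = col_mx (psi *m x + v *: y) (- (u *: x) + phi *m y).
Proof. by rewrite mul_block_col mulNmx !mul_scalar_mx. Qed.

Lemma phi_psi (x : 'cV[B]_n) : phi *m (psi *m x) = iota f *: x.
Proof. by rewrite mulmxA map_phipsi mul_scalar_mx. Qed.

End Matrices.

(** Change the sign of the second block of rows and columns. *)
Lemma knorrer_op n (m : matrix_factorization f n) :
  mod_iso (cok (mf_op (knorrer m))) (cok (knorrer (mf_op m))).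
Proof.
pose D : 'M[B]_(n + n) := block_mx 1%:M 0 0 (- 1%:M).
have DD : D *m D = 1%:M.
  rewrite mulmx_block !mulmx0 !mul0mx !addr0 !add0r mulmx1 mulmxN mulmx1 opprK.
  by rewrite -scalar_mx_block.
apply: (@cok_equiv _ _ _ _ _ _ D D D D) => //.
  rewrite !mulmx_block !mulmx0 !mul0mx !addr0 !add0r !mulmx1 !mul1mx !mulmxN !mulNmx.
  by rewrite !mulmx1 !mul1mx !opprK.
rewrite !mulmx_block !mulmx0 !mul0mx !addr0 !add0r !mulmx1 !mul1mx !mulmxN !mulNmx.
by rewrite !mulmx1 !mul1mx.
Qed.

Lemma knorrer_equiv n1 n2 (m1 : matrix_factorization f n1) (m2 : matrix_factorization f n2) :
  local_ring S -> nonzerodivisor f -> reduced m1 -> reduced m2 ->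
  mod_iso (cok m1) (cok m2) -> mod_iso (cok (knorrer m1)) (cok (knorrer m2)).
Proof.
move=> loc nzf red1 red2 iso.
have [D [D' [E [E' [[DE ED DE' ED'] hphi hpsi]]]]] := reduced_cok_equiv loc nzf red1 red2 iso.
have hphi' : E *m mf_phi m2 = mf_phi m1 *m E'.
  by rewrite -[LHS]mulmx1 -DE' -(mulmxA E) (mulmxA (mf_phi m2)) -hphi !mulmxA ED mul1mx.
have hpsi' : E' *m mf_psi m2 = mf_psi m1 *m E.
  by rewrite -[LHS]mulmx1 -DE -(mulmxA E') (mulmxA (mf_psi m2)) -hpsi !mulmxA ED' mul1mx.
pose blk p q (X Y : 'M[S]_(p, q)) := block_mx (map_mx iota X) 0 0 (map_mx iota Y).
have blk1 k l (X Y : 'M[S]_(k, l)) (X' Y' : 'M_(l, k)) : X *m X' = 1%:M -> Y *m Y' = 1%:M ->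
    blk _ _ X Y *m blk _ _ X' Y' = 1%:M.
  move=> hX hY; rewrite mulmx_block !mulmx0 !mul0mx !addr0 !add0r -!map_mxM hX hY.
  by rewrite !map_mx1 -scalar_mx_block.
have comm k l (m : matrix_factorization f k) (m' : matrix_factorization f l) X Y :
    X *m mf_phi m = mf_phi m' *m Y -> Y *m mf_psi m = mf_psi m' *m X ->
    blk _ _ X Y *m mf_phi (knorrer m) = mf_phi (knorrer m') *m blk _ _ Y X.
  move=> hX hY; rewrite !mulmx_block !mulmx0 !mul0mx !addr0 !add0r -!map_mxM hX hY.
  by rewrite mulmxN mulNmx !mul_mx_scalar !mul_scalar_mx.
by apply: cok_equiv (comm _ _ _ _ _ _ hphi hpsi) (comm _ _ _ _ _ _ hphi' hpsi') _ _;
  apply: blk1.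
Qed.

(** The four blocks of coordinates are reordered. *)
Lemma knorrer_sum n1 n2 (m1 : matrix_factorization f n1) (m2 : matrix_factorization f n2) :
  mod_iso (cok (knorrer (mf_sum m1 m2))) (cok (knorrer m1) * cok (knorrer m2))%type.
Proof.
pose g (x : 'cV[B]_((n1 + n2) + (n1 + n2))) :=
  (cpi (knorrer m1) (col_mx (usubmx (usubmx x)) (usubmx (dsubmx x))),
   cpi (knorrer m2) (col_mx (dsubmx (usubmx x)) (dsubmx (dsubmx x)))).
have phiE a b c d : mf_phi (knorrer (mf_sum m1 m2)) *m
    col_mx (col_mx a b) (col_mx c d) =
  col_mx (col_mx (usubmx (mf_phi (knorrer m1) *m col_mx a c))
                 (usubmx (mf_phi (knorrer m2) *m col_mx b d)))
         (col_mx (dsubmx (mf_phi (knorrer m1) *m col_mx a c))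
                 (dsubmx (mf_phi (knorrer m2) *m col_mx b d))) :> 'cV_(_ + _).
  rewrite !knorrer_phiE !col_mxKu !col_mxKd /= !map_block_mx !map_mx0.
  rewrite !mul_block_col !mul0mx !addr0 !add0r !scale_col_mx.
  by rewrite opp_col_mx !add_col_mx.
apply: (@cok_iso _ _ _ _ _ g) => [x y|a x|[x y]|x].
- by rewrite /g !linearD -!add_col_mx !cpiD.
- by rewrite /g !linearZ /= -!scale_col_mx !cpiZ.
- exists (col_mx (col_mx (usubmx (crepr x)) (usubmx (crepr y)))
                 (col_mx (dsubmx (crepr x)) (dsubmx (crepr y)))).
  by rewrite /g !(col_mxKu, col_mxKd) !vsubmxK !cpiK.
rewrite /g; split=> [[/cpi0P[y hy] /cpi0P[z hz]]|[z ->]].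
  exists (col_mx (col_mx (usubmx y) (usubmx z)) (col_mx (dsubmx y) (dsubmx z))).
  rewrite phiE !vsubmxK -hy -hz !(col_mxKu, col_mxKd).
  by rewrite !vsubmxK.
rewrite -[z]vsubmxK -[usubmx z]vsubmxK -[dsubmx z]vsubmxK phiE.
rewrite !(col_mxKu, col_mxKd) !vsubmxK.
by congr pair; apply/cpi0P; eexists.
Qed.


Hypothesis nzf : nonzerodivisor f.
Hypotheses (iotaK : cancel iota ev) (ev_u : ev u = 0) (ev_v : ev v = 0).
Hypothesis ev_split : forall x, exists s t, x = iota (ev x) + u * s + v * t.
Hypothesis uv_koszul :
  forall y z, u * y + v * z = 0 -> exists w, y = v * w /\ z = - (u * w).
Hypothesis nzF : nonzerodivisor F.
Hypothesis v_regular : forall x y, v * x = F * y -> exists z, x = F * z.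

Section Kernels.
Variables (n : nat) (m : matrix_factorization f n).
Local Notation phi := (map_mx iota (mf_phi m)).
Local Notation psi := (map_mx iota (mf_psi m)).
Local Notation kphi := (mf_phi (knorrer m)).
Local Notation kpsi := (mf_psi (knorrer m)).

Lemma col_ev_split (x : 'cV[B]_n) : exists s t,
  x = map_mx iota (map_mx ev x) + u *: s + v *: t.
Proof. by apply: col_split => i; rewrite !mxE; apply: ev_split. Qed.

(** The solutions of the linear system (phi u v) over B modulo f + uv.  After
    subtracting the multiple e of f + uv = phi psi + u v, the first unknown a' vanishes
    under [ev], hence is u s + v t, and u (phi s + b) + v (phi t + c - u e) = 0 is
    a Koszul relation with quotient w. *)
Lemma koszul_kernel (a b c e : 'cV[B]_n) : phi *m a + u *: b + v *: c = F *: e ->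
  exists x y, [/\ a = usubmx (kpsi *m x) + dsubmx (kphi *m y),
    b = - usubmx (kphi *m y) & c = - dsubmx (kpsi *m x)].
Proof.
move=> h; have [a' ea'] : exists a', a' = a - psi *m e by exists (a - psi *m e).
have h' : phi *m a' + u *: b + v *: (c - u *: e) = 0.
  rewrite ea' mulmxBr phi_psi scalerBr scalerA [v * u]mulrC.
  by rewrite [_ - _ + u *: b]addrAC addrACA -opprD -scalerDl h subrr.
have a'0 : map_mx ev a' = 0.
  apply: (mf_phi_inj (m := m) nzf); rewrite mulmx0.
  move/(congr1 (map_mx ev)): h'.
  rewrite !map_mxD !map_mxZ /= ev_u ev_v !scale0r !addr0 map_mxM raddf0 => <-.
  by congr (_ *m _); apply/matrixP => i j; rewrite !mxE /= iotaK.
have [s [t est]] := col_ev_split a'; rewrite a'0 raddf0 add0r in est.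
have [w [w1 w2]] : exists w, phi *m s + b = v *: w /\ phi *m t + (c - u *: e) = - (u *: w).
  apply: (col_koszul uv_koszul); rewrite -[RHS]h' est mulmxDr -!scalemxAr !scalerDr.
  by rewrite addrACA addrA addrAC.
(* The coefficients e - w and w share out psi e, the difference of a and a'. *)
exists (col_mx (e - w) t), (col_mx s w).
rewrite knorrer_phiE knorrer_psiE !col_mxKu !col_mxKd; split.
- rewrite -[LHS](subrK (psi *m e)) -ea' est mulmxBr.
  rewrite [X in _ = X + _]addrAC [RHS]addrACA addNr addr0.
  by rewrite [RHS]addrC [X in _ = _ + X]addrC addrA.
- by rewrite opprB -w1 addrC addKr.
- rewrite scalerBr opprD opprK; move/eqP: w2; rewrite addrA subr_eq => /eqP w2.
  by rewrite -[LHS](addKr (phi *m t)) w2 [RHS]addrC [u *: e - _]addrC.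
Qed.

(** The first coordinate of kpsi (kphi y) = F y shows that v times the second block of
    kphi y is divisible by F, hence so is that block; then F divides kphi y and also
    kpsi x. *)
Lemma koszul_relations x y (e1 e2 e3 : 'cV[B]_n) :
  usubmx (kpsi *m x) + dsubmx (kphi *m y) = F *: e1 ->
  usubmx (kphi *m y) = F *: e2 -> dsubmx (kpsi *m x) = F *: e3 ->
  (exists z, x = kphi *m z) /\ (exists z, y = kpsi *m z).
Proof.
move=> h1 h2 h3.
have [e he] : exists e, dsubmx (kphi *m y) = F *: e.
  have : kpsi *m (kphi *m y) = F *: y by rewrite mulmxA mf_psiphi mul_scalar_mx.
  rewrite -[kphi *m y in X in X -> _]vsubmxK knorrer_psiE => /(congr1 usubmx).
  rewrite col_mxKu h2 -scalemxAr => h.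
  apply: (col_regular v_regular (y := usubmx y - psi *m e2)).
  have eU : usubmx (F *: y) = F *: usubmx y by rewrite linearZ.
  by rewrite scalerBr -eU -h [RHS]addrC addKr.
split.
  exists (col_mx (e1 - e) e3); apply: (mf_kernel (m := mf_op (knorrer m)) nzF).
  rewrite -[LHS]vsubmxK /= h3 scale_col_mx scalerBr -h1 -he.
  by rewrite addrK.
exists (col_mx e2 e); apply: (mf_kernel (m := knorrer m) nzF).
by rewrite -[LHS]vsubmxK /= h2 he scale_col_mx.
Qed.

End Kernels.
End Hypersurface.

(** * Minimal resolutions *)

Section QuotientMatrices.
Variables (T : comPzRingType) (a : T).

Lemma rpi_mx_lift p q (Z : 'M[rquot a]_(p, q)) : exists X, Z = map_mx (rpi a) X.
Proof.
by exists (map_mx (@rrepr _ a) Z); apply/matrixP => i j; rewrite !mxE rpiK.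
Qed.

Lemma rpi_mx0 p q (X : 'M[T]_(p, q)) : map_mx (rpi a) X = 0 <-> exists Y, X = a *: Y.
Proof.
split=> [/matrixP h|[Y ->]].
  have /choice[c hc] : forall ij, exists c, X ij.1 ij.2 = c * a.
    move=> [i j]; have := h i j; rewrite !mxE -(rmorph0 (rpi a)).
    by move=> /rpiP[c]; rewrite subr0; exists c.
  by exists (\matrix_(i, j) c (i, j)); apply/matrixP => i j; rewrite !mxE (hc (i, j)) mulrC.
apply/matrixP => i j; rewrite !mxE -(rmorph0 (rpi a)); apply/rpiP.
by exists (Y i j); rewrite subr0 mulrC.
Qed.

(** Identifies a syzygy module, which is the image of a matrix over the quotient ring,
    with a cokernel over T, by a matrix G over T followed by a change of basis D. *)
Lemma im_mod_iso p k r r' (m : matrix_factorization a k) (G : 'M[T]_(p, k))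
    (D : 'M[rquot a]_(r, p)) (d : 'M[rquot a]_(r, r')) :
  (forall x : 'cV_k, exists y, D *m map_mx (rpi a) (G *m x) = d *m y) ->
  (forall y : 'cV_r', exists x, d *m y = D *m map_mx (rpi a) (G *m x)) ->
  (forall x : 'cV_k, D *m map_mx (rpi a) (G *m x) = 0 <-> exists z, x = mf_phi m *m z) ->
  mod_iso (cok m) (im_mod d).
Proof.
move=> hsub hsurj hker.
have inim (x : 'cV[T]_k) : im_pred d (D *m map_mx (rpi a) (G *m x)).
  by apply/asboolP; have [y ->] := hsub x; exists y.
apply: (@cok_iso _ _ _ m _ (fun x => ImMod (inim x))) => [x y|c x|[y py]|x].
- by apply: val_inj; rewrite /= mulmxDr map_mxD mulmxDr.
- by apply: val_inj; rewrite /= -scalemxAr map_mxZ -scalemxAr.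
- have /asboolP[z ez] := py; have [x hx] := hsurj z.
  by exists x; apply: val_inj; rewrite /= -hx -ez.
- by rewrite -hker; split=> [/(congr1 val)|h]; [|apply: val_inj].
Qed.

End QuotientMatrices.

Section Resolutions.
Variables (R : comPzRingType) (M : lmodType R) (P : min_resolution M).
Hypothesis locR : local_ring R.

Lemma mr_aug_kernel_max x : mr_aug P x = 0 -> forall i, maxideal (x i 0).
Proof.
move=> /mr_exact0[y ->] i; apply: mulmx_in_ideal; first exact: maxideal_ideal.
exact: mr_min.
Qed.

Lemma mr_diff_kernel_max i (x : 'cV_(mr_rank P i.+1)) :
  mr_diff P i *m x = 0 -> forall j, maxideal (x j 0).
Proof.
move=> /mr_exact[y ->] j; apply: mulmx_in_ideal; first exact: maxideal_ideal.
exact: mr_min.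
Qed.

Lemma mr_aug_cover n (q : {linear 'cV[R]_n -> M}) : (forall y, exists x, q x = y) ->
  (forall x, q x = 0 -> forall i, maxideal (x i 0)) ->
  exists D E, [/\ D *m E = 1%:M, E *m D = 1%:M & forall x, mr_aug P (D *m x) = q x].
Proof.
move=> surj qmax; apply: minimal_covers_iso => //; last exact: mr_aug_kernel_max.
by move=> x; have [y ->] := mr_surj P (q x); exists y.
Qed.

End Resolutions.



Section FirstSyzygy.
Variables (S : comPzRingType) (f : S).
Hypotheses (locS : local_ring S) (maxf : maxideal f) (nzf : nonzerodivisor f).
Variables (n : nat) (m : matrix_factorization f n) (M : lmodType (rquot f)).
Hypotheses (redm : reduced m) (isoM : mod_iso M (cok m)).

Lemma phi_max (z : 'cV[S]_n) i : maxideal ((mf_phi m *m z) i 0).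
Proof.
apply: mulmx_in_ideal; first exact: maxideal_ideal.
by move=> i' j'; have [] := redm i' j'.
Qed.

(** The surjection S^n -> cok m = M, viewed over a ring A that acts on N = M through
    S/(f) and is itself a quotient of B.  It is used twice: with A = S/(f) and B = S
    for the resolution over S/(f), and with A = B/(f + uv) for the resolution over A. *)
Lemma presentation (B A : comPzRingType) (pi : {rmorphism B -> A}) (ev : {rmorphism B -> S})
    (rho : {rmorphism A -> rquot f}) (N : lmodType A) (toN : M -> N) :
  (forall b, rho (pi b) = rpi f (ev b)) ->
  (forall x y, toN (x + y) = toN x + toN y) ->
  (forall a x, toN (rho a *: x) = a *: toN x) ->
  (forall x, toN x = 0 -> x = 0) -> (forall y, exists x, toN x = y) ->
  (forall s, exists b, ev b = s) ->
  exists q : {linear 'cV[A]_n -> N},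
    (forall y, exists x, q (map_mx pi x) = y) /\
    (forall x, q (map_mx pi x) = 0 <-> exists z, map_mx ev x = mf_phi m *m z).
Proof.
move=> hrho nD nZ ninj nsurj evsurj; have [h [hinj hsurj]] := mod_iso_inv isoM.
have n0 : toN 0 = 0 by apply: (@addrI _ (toN 0)); rewrite -nD !addr0.
pose q : {linear 'cV[A]_n -> N} := lincomb (fun j : 'I_n => toN (h (cpi m (delta_mx j 0)))).
have qE (x : 'cV[B]_n) : q (map_mx pi x) = toN (h (cpi m (map_mx ev x))).
  rewrite [map_mx ev x]column_sum.
  have -> : cpi m (\sum_j map_mx ev x j 0 *: delta_mx j 0) =
            \sum_j rpi f (ev (x j 0)) *: cpi m (delta_mx j 0).
    rewrite (big_morph _ (cpiD m) ((cpi0P m 0).2 _)); last by exists 0; rewrite mulmx0.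
    by apply: eq_bigr => j _; rewrite mxE cpiZ.
  rewrite linear_sum (big_morph _ nD n0) /= /lincomb; apply: eq_bigr => j _.
  by rewrite mxE linearZ_LR -hrho nZ.
exists q; split=> [y|x].
  have [x <-] := nsurj y; have [c <-] := hsurj x.
  have /choice[b hb] := fun i => evsurj (crepr c i 0).
  exists (\col_i b i); rewrite qE -[in RHS](cpiK c); congr (toN (h (cpi m _))).
  by apply/colP => i; rewrite !mxE.
rewrite qE; split=> [/ninj /hinj /cpi0P //|/cpi0P ->].
by rewrite raddf0.
Qed.

(** The kernel of the presentation over S/(f) is the image of phi, and
    phi x = 0 modulo f means that x lies in the image of psi. *)
Lemma first_syzygy (P : min_resolution M) : mod_iso (cok (mf_op m)) (syz P 1).
Proof.
have [||||||q [qsurj qker]] := @presentation S (rquot f) (rpi f) idfun idfun M id => //.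
- by move=> y; exists y.
- by move=> s; exists s.
have locR := rquot_local locS maxf.
have [||D [E [DE ED hD]]] := @mr_aug_cover _ _ P locR _ q.
- by move=> y; have [x <-] := qsurj y; exists (map_mx (rpi f) x).
- move=> x; have [X ->] := rpi_mx_lift x => /qker[z]; rewrite map_mx_id // => -> i.
  by rewrite mxE; apply/maxideal_rpi => //; apply: phi_max.
apply: (im_mod_iso (G := mf_phi m) (D := D)) => [x|y|x].
- by apply/mr_exact0; rewrite hD; apply/qker; exists x; rewrite map_mx_id.
- have /mr_exact0 : exists y', mr_diff P 0 *m y = mr_diff P 0 *m y' by exists y.
  have [X eX] := rpi_mx_lift (E *m (mr_diff P 0 *m y)).
  have -> : mr_diff P 0 *m y = D *m map_mx (rpi f) X by rewrite -eX mulmxA DE mul1mx.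
  by rewrite hD => /qker[z]; rewrite map_mx_id // => ->; exists z.
split=> [|[z ->]].
  move/(congr1 (mulmx E)); rewrite mulmxA ED mul1mx mulmx0 => /rpi_mx0[y].
  by move=> /(mf_kernel nzf); exists y.
suff -> : map_mx (rpi f) (mf_phi m *m (mf_phi (mf_op m) *m z)) = 0 by rewrite mulmx0.
by apply/rpi_mx0; exists z; rewrite mulmxA mf_phipsi mul_scalar_mx.
Qed.

End FirstSyzygy.

(** * The second syzygy over the hypersurface f + uv *)

Section SecondSyzygy.
Variables (S B : comPzRingType) (iota : {rmorphism S -> B}) (ev : {rmorphism B -> S}).
Variables (u v : B) (f : S).
Local Notation F := (iota f + u * v).
Hypotheses (locS : local_ring S) (locB : local_ring B).
Hypothesis maxideal_ev : forall b, maxideal b <-> maxideal (ev b).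
Hypotheses (maxf : maxideal f) (nzf : nonzerodivisor f).
Hypotheses (iotaK : cancel iota ev) (ev_u : ev u = 0) (ev_v : ev v = 0).
Hypothesis ev_split : forall x, exists s t, x = iota (ev x) + u * s + v * t.
Hypothesis uv_koszul :
  forall y z, u * y + v * z = 0 -> exists w, y = v * w /\ z = - (u * w).
Hypothesis nzF : nonzerodivisor F.
Hypothesis v_regular : forall x y, v * x = F * y -> exists z, x = F * z.

Lemma maxideal_F : maxideal F.
Proof. by apply/maxideal_ev; rewrite rmorphD rmorphM iotaK ev_u mul0r addr0. Qed.

Lemma knorrer_reduced n (m : matrix_factorization f n) :
  reduced m -> reduced (knorrer iota u v m).
Proof.
move=> red; have iB := maxideal_ideal locB; have B0 := ideal0 iB.
have mu : maxideal u by apply/maxideal_ev; rewrite ev_u; exact: ideal0 (maxideal_ideal locS).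
have mv : maxideal v by apply/maxideal_ev; rewrite ev_v; exact: ideal0 (maxideal_ideal locS).
have miota i j : maxideal (iota (mf_phi m i j)) /\ maxideal (iota (mf_psi m i j)).
  by have [] := red i j; split; apply/maxideal_ev; rewrite iotaK.
have mn (x : B) k : maxideal x -> maxideal (x *+ k).
  by move=> mx; rewrite -mulr_natl; apply: idealM.
move=> i j; rewrite /= !mxE.
case: splitP => i' _; rewrite !mxE; case: splitP => j' _; rewrite !mxE;
  have [? ?] := miota i' j'; split=> //; by [apply: mn|apply: idealN => //; apply: mn].
Qed.

Variables (n : nat) (m : matrix_factorization f n) (M : lmodType (rquot f)).
Hypotheses (redm : reduced m) (isoM : mod_iso M (cok m)).
Variable rho : {rmorphism rquot F -> rquot f}.
Hypothesis rhoE : forall b, rho (rpi F b) = rpi f (ev b).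

Local Notation phi := (map_mx iota (mf_phi m)).
Local Notation psi := (map_mx iota (mf_psi m)).
Local Notation kphi := (mf_phi (knorrer iota u v m)).
Local Notation kpsi := (mf_psi (knorrer iota u v m)).
Local Notation pi := (map_mx (rpi F)).

(** The first two maps of the resolution of M over B/(f + uv). *)
Definition koszul1 : 'M[B]_(n, n + (n + n)) := row_mx phi (row_mx u%:M v%:M).

Definition koszul2 : 'M[B]_(n + (n + n), (n + n) + (n + n)) :=
  col_mx (row_mx (usubmx kpsi) (dsubmx kphi))
         (col_mx (row_mx 0 (- usubmx kphi)) (row_mx (- dsubmx kpsi) 0)).

Lemma koszul1E (a b c : 'cV[B]_n) :
  koszul1 *m col_mx a (col_mx b c) = phi *m a + u *: b + v *: c.
Proof. by rewrite !mul_row_col !mul_scalar_mx addrA. Qed.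

Lemma koszul2E (x y : 'cV[B]_(n + n)) : koszul2 *m col_mx x y =
  col_mx (usubmx (kpsi *m x) + dsubmx (kphi *m y))
    (col_mx (- usubmx (kphi *m y)) (- dsubmx (kpsi *m x))).
Proof.
rewrite /koszul2; move: kpsi kphi => p k.
rewrite !mul_col_mx !mul_row_col !mul0mx add0r addr0 !mulNmx.
by rewrite !mul_usub_mx !mul_dsub_mx.
Qed.

(** The two blocks of x contribute the first coordinate of kphi (kpsi x1) and the
    second coordinate of kpsi (kphi x2). *)
Lemma koszul12 (x : 'cV[B]_((n + n) + (n + n))) :
  exists e, koszul1 *m (koszul2 *m x) = F *: e.
Proof.
rewrite -[x]vsubmxK; set x1 := usubmx x; set x2 := dsubmx x.
exists (usubmx x1 + dsubmx x2); rewrite koszul2E koszul1E.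
have h1 : kphi *m (kpsi *m x1) = F *: x1 by rewrite mulmxA mf_phipsi mul_scalar_mx.
have h2 : kpsi *m (kphi *m x2) = F *: x2 by rewrite mulmxA mf_psiphi mul_scalar_mx.
move: h1; rewrite -[kpsi *m x1 in X in X -> _]vsubmxK knorrer_phiE => /(congr1 usubmx).
rewrite col_mxKu => h1.
move: h2; rewrite -[kphi *m x2 in X in X -> _]vsubmxK knorrer_psiE => /(congr1 dsubmx).
rewrite col_mxKd => h2.
have eU : usubmx (F *: x1) = F *: usubmx x1 by rewrite linearZ.
have eD : dsubmx (F *: x2) = F *: dsubmx x2 by rewrite linearZ.
rewrite scalerDr -eU -eD -h1 -h2 mulmxDr !scalerN [RHS]addrAC; congr (_ + _).
by rewrite -addrA [X in _ + X = _]addrC.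
Qed.

Lemma koszul_exact (w : 'cV[B]_(n + (n + n))) (e : 'cV[B]_n) :
  koszul1 *m w = F *: e ->
  exists x, w = koszul2 *m x.
Proof.
rewrite -[w]vsubmxK -[dsubmx w]vsubmxK koszul1E => /koszul_kernel.
move=> /(_ ev nzf iotaK ev_u ev_v ev_split uv_koszul)[x [y [-> -> ->]]].
by exists (col_mx x y); rewrite koszul2E.
Qed.

(** The relations between the generators of the second syzygy: it is the cokernel of
    the sum of X and of X with its maps exchanged. *)
Lemma koszul2_kernel (x : 'cV[B]_((n + n) + (n + n))) : pi (koszul2 *m x) = 0 <->
  exists z, x = mf_phi (mf_sum (knorrer iota u v m) (mf_op (knorrer iota u v m))) *m z.
Proof.
rewrite rpi_mx0; split=> [[Y]|[z ->]].
  rewrite -[x]vsubmxK -[Y]vsubmxK -[dsubmx Y]vsubmxK koszul2E !scale_col_mx.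
  move=> /eq_col_mx[h1 /eq_col_mx[h2 h3]].
  have [||[z1 ->] [z2 ->]] := koszul_relations nzF v_regular
    (e2 := - usubmx (dsubmx Y)) (e3 := - dsubmx (dsubmx Y)) h1.
  - by rewrite scalerN -h2 opprK.
  - by rewrite scalerN -h3 opprK.
  by exists (col_mx z1 z2); rewrite mul_block_col !mul0mx addr0 add0r.
rewrite -[z]vsubmxK mul_block_col !mul0mx addr0 add0r koszul2E.
have -> : kpsi *m (kphi *m usubmx z) = F *: usubmx z.
  by rewrite mulmxA mf_psiphi mul_scalar_mx.
have -> : kphi *m (mf_phi (mf_op (knorrer iota u v m)) *m dsubmx z) = F *: dsubmx z.
  by rewrite mulmxA mf_phipsi mul_scalar_mx.
exists (col_mx (usubmx (usubmx z) + dsubmx (dsubmx z))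
  (col_mx (- usubmx (dsubmx z)) (- dsubmx (usubmx z)))).
by rewrite !scale_col_mx scalerDr !scalerN !linearZ.
Qed.

Lemma koszul2_max (x : 'cV[B]_((n + n) + (n + n))) i : maxideal ((koszul2 *m x) i 0).
Proof.
have iB := maxideal_ideal locB; have B0 := ideal0 iB.
have hk i' j : maxideal (kphi i' j) by have [] := knorrer_reduced redm i' j.
have hp i' j : maxideal (kpsi i' j) by have [] := knorrer_reduced redm i' j.
apply: mulmx_in_ideal => // {}i j; rewrite /koszul2; move: kphi kpsi hk hp => k p hk hp.
rewrite mxE; case: splitP => i' _; rewrite mxE; case: splitP => j' _; rewrite mxE //.
  by case: splitP => l _; rewrite !mxE //; apply: idealN.
by case: splitP => l _; rewrite !mxE //; apply: idealN.
Qed.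

(** [koszul1] and [koszul2] are compared with the given resolution one step at a time:
    first the covers of M, then those of the first syzygy inside the free module of
    rank [mr_rank Q 0]. *)
Lemma second_syzygy (Q : min_resolution (restrict rho M)) :
  mod_iso (cok (mf_sum (knorrer iota u v m) (mf_op (knorrer iota u v m)))) (syz Q 2).
Proof.
have locA := rquot_local locB maxideal_F.
have [|||||q [qsurj qker0]] :=
  @presentation S f n m M isoM B (rquot F) (rpi F) ev rho (restrict rho M) id rhoE => //.
- by move=> y; exists y.
- by move=> s; exists (iota s); rewrite iotaK.
have qker x : q (pi x) = 0 <-> exists w, pi x = pi (koszul1 *m w).
  split=> [/qker0[z hz]|[w ->]].
    have [s [t est]] := col_ev_split ev_split x.
    exists (col_mx (map_mx iota z) (col_mx s t)).
    by rewrite koszul1E -map_mxM -hz -est.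
  apply/qker0; exists (map_mx ev (usubmx w)).
  rewrite -[w in LHS]vsubmxK -[dsubmx w]vsubmxK koszul1E !map_mxD !map_mxZ /= ev_u ev_v.
  rewrite !scale0r !addr0 map_mxM; congr (_ *m _).
  by apply/matrixP => i j; rewrite !mxE /= iotaK.
have [||D [E [DE ED hD]]] := @mr_aug_cover _ _ Q locA _ q.
- by move=> y; have [x <-] := qsurj y; exists (pi x).
- move=> x; have [X ->] := rpi_mx_lift x => /qker0[z hz] i.
  rewrite mxE; apply/(maxideal_rpi locB maxideal_F)/maxideal_ev.
  have -> : ev (X i 0) = map_mx ev X i 0 by rewrite mxE.
  by rewrite hz; apply: phi_max.
have kerE (w : 'cV_(n + (n + n))) : D *m pi (koszul1 *m w) = 0 -> exists x, w = koszul2 *m x.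
  move/(congr1 (mulmx E)); rewrite mulmxA ED mul1mx mulmx0 => /rpi_mx0[e].
  exact: koszul_exact.
have piM (w : 'cV_(n + (n + n))) : pi koszul1 *m pi w = pi (koszul1 *m w) by rewrite map_mxM.
have [||||D2 [E2 [DE2 ED2 hD2]]] := @minimal_covers_iso _ locA _ _ _
  (mulmx (D *m pi koszul1) : {linear 'cV_(n + (n + n)) -> 'cV_(mr_rank Q 0)})
  (mulmx (mr_diff Q 0) : {linear 'cV_(mr_rank Q 1) -> 'cV_(mr_rank Q 0)}).
- move=> x; have [w ->] := rpi_mx_lift x; rewrite /= -mulmxA piM.
  have /mr_exact0[y ey] : mr_aug Q (D *m pi (koszul1 *m w)) = 0.
    by rewrite hD; apply/qker; exists w.
  by exists y.
- move=> y; have [X eX] := rpi_mx_lift (E *m (mr_diff Q 0 *m y)).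
  have /qker[w hw] : q (pi X) = 0.
    by rewrite -hD -eX mulmxA DE mul1mx; apply/mr_exact0; exists y.
  exists (pi w); rewrite /= -mulmxA piM -hw -eX (mulmxA D) DE.
  by rewrite mul1mx.
- move=> x; have [w ->] := rpi_mx_lift x; rewrite /= -mulmxA piM => /kerE[{}x ->] i.
  by rewrite mxE; apply/(maxideal_rpi locB maxideal_F); apply: koszul2_max.
- by move=> y /= hy; apply: (mr_diff_kernel_max (P := Q) (i := 0) locA hy).
rewrite /= in hD2; apply: (im_mod_iso (G := koszul2) (D := D2)) => [x|y|x].
- apply/mr_exact; rewrite hD2 -mulmxA piM.
  suff -> : pi (koszul1 *m (koszul2 *m x)) = 0 by rewrite mulmx0.
  by apply/rpi_mx0; apply: koszul12.
- have /mr_exact h : exists y', mr_diff Q 1 *m y = mr_diff Q 1 *m y' by exists y.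
  have [w ew] := rpi_mx_lift (E2 *m (mr_diff Q 1 *m y)).
  have ey : mr_diff Q 1 *m y = D2 *m pi w by rewrite -ew mulmxA DE2 mul1mx.
  have [|x ex] := kerE w; first by rewrite -piM mulmxA -hD2 -ey.
  by exists x; rewrite ey ex.
rewrite -koszul2_kernel; split=> [|->]; last by rewrite mulmx0.
by move/(congr1 (mulmx E2)); rewrite mulmxA ED2 mul1mx mulmx0.
Qed.

End SecondSyzygy.

(** * Power series rings *)

Section PowerSeriesLocal.
Variable R : comPzRingType.
Implicit Types a b : powser R.

(** Course-of-values recursion; t0 is a filler for the values not yet defined. *)
Lemma strong_recursion (T : Type) (t0 : T) (F : nat -> (nat -> T) -> T) :
  exists b : nat -> T, forall n, b n = F n (fun k => if (k < n)%N then b k else t0).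
Proof.
pose B := fix B n : nat -> T := if n is k.+1 then
  fun j => if j == k then F k (B k) else B k j else fun=> t0.
exists (fun n => B n.+1 n) => n; rewrite /= eqxx; congr F.
elim: n => [|n IHn]; apply/funext => k //=.
rewrite ltnS leq_eqVlt; case: eqP => [->|_] /=; first by rewrite eqxx.
by rewrite IHn.
Qed.

Lemma powser_invertible a : invertible (coef0 a) -> invertible a.
Proof.
move=> [c ca]; have [b hb] := strong_recursion (0 : R) (fun n d =>
  c * ((n == 0)%:R - \sum_(j < n) coefs a j.+1 * d (n - j.+1)%N)).
exists (PowSer b); rewrite mulrC; apply: powserP => n /=.
rewrite big_ord_recl /= subn0 hb mulrA [coefs a 0 * c]mulrC [c * _]ca mul1r.
have -> : \sum_(j < n) coefs a j.+1 * b (n - j.+1)%N =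
  \sum_(j < n) coefs a j.+1 * (if (n - j.+1 < n)%N then b (n - j.+1)%N else 0).
  apply: eq_bigr => j _; rewrite ifT //.
  by rewrite ltn_subrL /= (leq_ltn_trans _ (ltn_ord j)).
by rewrite subrK; case: eqP.
Qed.

Lemma maxideal_coef0 a : maxideal a <-> maxideal (coef0 a).
Proof.
split=> n h; apply: n; first exact: powser_invertible.
by case: h => b hb; exists (coef0 b); rewrite -rmorphM hb rmorph1.
Qed.

Lemma powser_local : local_ring R -> local_ring (powser R).
Proof.
move=> loc; have iM := maxideal_ideal loc; have [R1 _] := loc; split.
  by move=> /(congr1 (@coef0 R)).
split=> [|a b /maxideal_coef0 ma /maxideal_coef0 mb|a b /maxideal_coef0 mb].
- by apply/maxideal_coef0; apply: ideal0.
- by apply/maxideal_coef0; rewrite rmorphD; apply: idealD.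
- by apply/maxideal_coef0; rewrite rmorphM; apply: idealM.
Qed.

(** Look at the lowest nonzero coefficient of the other factor. *)
Lemma powser_nonzerodivisor a : nonzerodivisor (coef0 a) -> nonzerodivisor a.
Proof.
move=> nz b ab; apply: powserP => n /=; rewrite -[RHS]/(coefs (0 : powser R) n).
have -> : coefs (0 : powser R) n = 0 by rewrite /=; case: eqP.
elim/ltn_ind: n => n IHn; apply: nz.
have : coefs (a * b) n = 0 by rewrite ab /=; case: eqP.
rewrite /= big_ord_recl /= subn0 big1 ?addr0 // => j _.
by rewrite IHn ?mulr0 // ltn_subrL /= (leq_ltn_trans _ (ltn_ord j)).
Qed.

Lemma coefs_powserX a n : coefs (powserX * a) n = if n is k.+1 then coefs a k else 0.
Proof.
case: n => [|n] /=; first by rewrite big_ord1 mul0r.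
rewrite big_ord_recl big_ord_recl /= mul0r add0r mul1r subn1 big1 ?addr0 // => j _.
by rewrite mul0r.
Qed.

Lemma powserX_nonzerodivisor : nonzerodivisor (@powserX R).
Proof.
move=> a h; apply: powserP => n.
have := congr1 (fun b => coefs b n.+1) h; rewrite coefs_powserX => -> /=.
by case: eqP.
Qed.

Lemma powser_split a : exists b, a = powserC (coef0 a) + powserX * b.
Proof.
exists (PowSer (fun n => coefs a n.+1)); apply: powserP => n.
rewrite -[RHS]/(coefs (powserC (coef0 a)) n + coefs (powserX * _) n) coefs_powserX.
by case: n => [|n] /=; rewrite ?addr0 ?add0r.
Qed.

End PowerSeriesLocal.

Section PowerSeriesInTwoVariables.
Variables (S : comPzRingType) (f : S).
Local Notation B := (powser2 S).
Local Notation u := (ps_u S).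
Local Notation v := (ps_v S).

Definition ev (x : B) : S := coef0 (coef0 x).
HB.instance Definition _ := GRing.RMorphism.copy ev (@coef0 S \o @coef0 (powser S)).

Lemma ev_const : cancel (@ps_const S) ev. Proof. by []. Qed.
Lemma ev_u : ev u = 0. Proof. by []. Qed.
Lemma ev_v : ev v = 0. Proof. by []. Qed.
Lemma ev_fuv : ev (fuv f) = f. Proof. exact: coef00_fuv. Qed.

Lemma maxideal_ev x : maxideal x <-> maxideal (ev x).
Proof. by rewrite maxideal_coef0 maxideal_coef0. Qed.

Lemma ev_split (x : B) : exists s t, x = ps_const (ev x) + u * s + v * t.
Proof.
have [t et] := powser_split x; have [s es] := powser_split (coef0 x).
exists (powserC s), t.
by rewrite {1}et es rmorphD rmorphM.
Qed.

(** The syzygies of u and v are the Koszul ones, since u is regular on S[[u]] and v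
    on S[[u,v]]. *)
Lemma uv_koszul (y z : B) : u * y + v * z = 0 -> exists w, y = v * w /\ z = - (u * w).
Proof.
move=> h; have y0 : coef0 y = 0.
  apply: powserX_nonzerodivisor; move/(congr1 (@coef0 _)): h.
  by rewrite rmorphD !rmorphM rmorph0 /= /coef0 /= mul0r addr0.
have [w ew] := powser_split y; rewrite y0 rmorph0 add0r in ew.
exists w; split=> //; apply/eqP; rewrite -addr_eq0; apply/eqP.
by apply: powserX_nonzerodivisor; rewrite -[RHS]h ew /ps_v; ring.
Qed.

Hypothesis nzf : nonzerodivisor f.

Lemma coef0_fuv_nonzerodivisor : nonzerodivisor (coef0 (fuv f)).
Proof. by apply: powser_nonzerodivisor; rewrite [X in nonzerodivisor X]ev_fuv. Qed.

Lemma v_regular (x y : B) : v * x = fuv f * y -> exists z, x = fuv f * z.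
Proof.
move=> h; have y0 : coef0 y = 0.
  by apply: coef0_fuv_nonzerodivisor; rewrite -rmorphM -h rmorphM /= mul0r.
have [w ew] := powser_split y; rewrite y0 rmorph0 add0r in ew.
exists w; apply/eqP; rewrite -subr_eq0; apply/eqP; apply: powserX_nonzerodivisor.
by rewrite mulrBr [X in X - _]h ew; ring.
Qed.

(** The two factorizations have the same matrices but different proofs, so they are
    related by identity matrices rather than by conversion. *)
Lemma cross_knorrer n (m : matrix_factorization f n) :
  mod_iso (cok (cross_mf m))
    (cok (knorrer (@ps_const S) u v m : matrix_factorization (fuv f) _)).
Proof.
by apply: (@cok_equiv _ _ _ _ _ _ 1%:M 1%:M 1%:M 1%:M); rewrite ?mul1mx ?mulmx1.
Qed.

End PowerSeriesInTwoVariables.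

Theorem theoremB (S : comPzRingType) (f : S) (M : lmodType (hyp_R f))
    (P : min_resolution M) (Q : min_resolution (inflate M))
    (Mx Kx MKx : lmodType (hyp_A f)) :
  regular_local_ring S ->
  adic_complete (@maxideal S) ->
  f != 0 ->
  ideal_pow (@maxideal S) 2 f ->
  mcm M ->
  ~ has_free_summand M ->
  is_cross M Mx ->
  is_cross (syz P 1) Kx ->
  is_cross (M * syz P 1)%type MKx ->
  [/\ mod_iso (syz Q 2) (Mx * Kx)%type,
      mod_iso (Mx * Kx)%type MKx,
      ~ has_free_summand (syz Q 2),
      ~ has_free_summand (Mx * Kx)%type &
      ~ has_free_summand MKx].
Proof.
move=> reg _ f0 f2 _ nofree [n [m [isoM /(_ nofree) red isoMx]]].
move=> [k [m' [isoK red' isoKx]]] [l [m'' [isoMK red'' isoMKx]]].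
have [_ loc _] := reg; have iM := maxideal_ideal loc.
have nzf : nonzerodivisor f.
  by move=> x /(regular_local_domain reg)[/eqP|//]; rewrite (negPf f0).
have maxf : maxideal f.
  have [r [a [b [hab ->]]]] := f2; apply: ideal_sum => // i _.
  by rewrite mulrC; apply: idealM => //; case: (hab i).
have locB := powser_local (powser_local loc).
have maxF : maxideal (fuv f) by apply/maxideal_ev; rewrite ev_fuv.
have nzF : nonzerodivisor (fuv f).
  by apply/powser_nonzerodivisor/coef0_fuv_nonzerodivisor.
pose kn q (w : matrix_factorization f q) : matrix_factorization (fuv f) (q + q) :=
  knorrer (@ps_const S) (ps_u S) (ps_v S) w.
have cross_iso q (w : matrix_factorization f q) q' (w' : matrix_factorization f q') :
    reduced w -> reduced w' -> mod_iso (cok w) (cok w') ->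
    mod_iso (cok (cross_mf w)) (cok (kn _ w')).
  move=> rw rw' iso; apply: mod_iso_trans (cross_knorrer w) _.
  exact: knorrer_equiv.
have redop := mf_op_reduced red.
have isoP : mod_iso (syz P 1) (cok (mf_op m)).
  by apply/mod_iso_sym/first_syzygy.
have nofreeP : ~ has_free_summand (syz P 1).
  by move/(free_summand_iso isoP); apply: reduced_no_free_summand.
have redsum : reduced (mf_sum m (mf_op m)) by apply: mf_sum_reduced.
have isoMP : mod_iso (M * syz P 1)%type (cok (mf_sum m (mf_op m))).
  by apply: mod_iso_trans (mod_iso_prod isoM isoP) _; apply/mod_iso_sym/mf_sum_cok.
have nofreeMP : ~ has_free_summand (M * syz P 1)%type.
  by move/(free_summand_iso isoMP); apply: reduced_no_free_summand.
have knM : mod_iso Mx (cok (kn _ m)).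
  by apply: mod_iso_trans isoMx (cross_knorrer m).
have knK : mod_iso Kx (cok (kn _ (mf_op m))).
  apply: mod_iso_trans isoKx _; apply: cross_iso => //; first exact: red'.
  by apply: mod_iso_trans isoP; apply: mod_iso_sym.
have knMK : mod_iso MKx (cok (kn _ (mf_sum m (mf_op m)))).
  apply: mod_iso_trans isoMKx _; apply: cross_iso => //; first exact: red''.
  by apply: mod_iso_trans isoMP; apply: mod_iso_sym.
have isoA : mod_iso (Mx * Kx)%type MKx.
  apply: mod_iso_trans (mod_iso_prod knM knK) _; apply: mod_iso_sym.
  by apply: mod_iso_trans knMK _; apply: knorrer_sum.
pose W := mf_sum (kn _ m) (mf_op (kn _ m)).
have isoQ : mod_iso (cok W) (syz Q 2).
  apply: (second_syzygy loc locB (@maxideal_ev S) maxf nzf (@ev_const S) (ev_u S) (ev_v S)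
    (@ev_split S) (@uv_koszul S) nzF (v_regular nzf) red isoM (@A_to_RE S f)).
have isoW : mod_iso (cok W) (Mx * Kx)%type.
  apply: mod_iso_trans (mf_sum_cok _ _) _; apply: mod_iso_sym.
  apply: mod_iso_trans (mod_iso_prod knM knK) _; apply: mod_iso_prod.
    exact: mod_iso_refl.
  by apply: mod_iso_sym; apply: knorrer_op.
have nofreeW : ~ has_free_summand (cok W).
  apply: reduced_no_free_summand => //.
  have redk : reduced (kn _ m).
    by apply: (knorrer_reduced loc locB (@maxideal_ev S) (@ev_const S) (ev_u S) (ev_v S)).
  by apply: mf_sum_reduced => //; apply: mf_op_reduced.
have nofreeMxKx : ~ has_free_summand (Mx * Kx)%type.
  by move/(free_summand_iso (mod_iso_sym isoW)).
split=> //.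
- exact: mod_iso_trans (mod_iso_sym isoQ) isoW.
- by move/(free_summand_iso (mod_iso_sym isoQ)).
- by move/(free_summand_iso (mod_iso_sym isoA)).
Qed.
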